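(* For every integer $n\ge 1$, the local parametrization $z(\lambda)=\alpha(\lambda)x(\lambda)$ of the curve patch $T\cap\Gamma$ on a cut triangle $T$ (defined in the context) satisfies $$\left|\partial_\lambda^n z(\lambda)\right|\le C\,h^{\lfloor n/2\rfloor+1},\qquad \lambda\in[0,1],$$ where $C$ may depend on $n$, on the smoothness and geometry of $\Gamma$, on the mesh shape-regularity constant, and on the uniform transversality constant, but is independent of $h$.
   Context: $\Gamma=\{x\in\mathbb{R}^2:F(x)=0\}$ is a compact regular level set ($\nabla F\neq0$ on $\Gamma$) of a smooth function $F$ with as many bounded derivatives near $\Gamma$ as needed. $r_\Gamma$ is the reach of $\Gamma$ (the supremum of all $r>0$ such that every $x$ with $\operatorname{dist}(x,\Gamma)<r$ has a unique closest point on $\Gamma$), $K_\Gamma$ is the maximum absolute curvature, and $n(\cdot)$ is the unit normal. We consider a family of shape-regular, quasi-uniform conforming triangular meshes of mesh size $h$ ($c_{\rm m}h\le h_T\le C_{\rm m}h$, $h_T=\operatorname{diam}T$). Every cut triangle $T$ (one with $T\cap\Gamma\ne\emptyset$) is assumed consistent with $\Gamma$: $h_T<r_\Gamma$, $h_TK_\Gamma\le\frac14$, and $\operatorname{dist}(a,\Gamma)>\max\{c_0h_T,K_\Gamma h_T^2\}$ for each vertex $a$ of $T$. It is also assumed uniformly transverse: $|n(z)\cdot\frac{a-z}{|a-z|}|\ge c_2>0$ for the apex vertex $a$ used below and all $z\in T\cap\Gamma$. The constants $c_0,c_2>0$ are independent of $h$ and $T$. On a cut triangle $T=\triangle o_0o_1o_2$,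 exactly one vertex, labelled $o_0$, has a sign of $F$ different from that of the other two. Coordinates are translated so that $o_0=(0,0)$. Let $p,q$ be the unique points of $\overline{o_0o_1}\cap\Gamma$ and $\overline{o_0o_2}\cap\Gamma$. Set $x(\lambda)=(1-\lambda)p+\lambda q$, $\lambda\in[0,1]$; let $\alpha(\lambda)>0$ be the unique number such that $\alpha(\lambda)x(\lambda)\in T$ and $F(\alpha(\lambda)x(\lambda))=0$; and set $z(\lambda)=\alpha(\lambda)x(\lambda)$. *)

(* Defs.v *)
From HB Require Import structures.
From mathcomp Require Export all_boot all_order all_algebra.
From mathcomp Require Export all_classical all_reals all_analysis.

Set Implicit Arguments.
Unset Strict Implicit.
Unset Printing Implicit Defensive.

Export Order.TTheory GRing.Theory Num.Theory.
Export numFieldNormedType.Exports.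

Local Open Scope classical_set_scope.
Local Open Scope ring_scope.

Section Euclid.
Context {R : realType}.
Local Notation pt := 'rV[R]_2.

(* The library norm on ['rV[R]_2] is the max norm (same topology), so the
   Euclidean structure is given by [dot] and [enorm]. *)
Definition dot (u v : pt) : R := \sum_(i < 2) u 0 i * v 0 i.
Definition enorm (u : pt) : R := Num.sqrt (dot u u).

(* The values of [inf] and [sup] below are only meaningful for nonempty
   (bounded) sets; they are used on [Gamma F] only when it meets a triangle. *)
Definition dist (x : pt) (A : set pt) : R :=
  inf [set enorm (x - y) | y in A].
Definition diam (A : set pt) : R :=
  sup [set d | exists x y, [/\ A x, A y & d = enorm (x - y)]].

Definition has_unique_projection (A : set pt) (x : pt) : Prop :=
  exists! y, A y /\ enorm (x - y) = dist x A.

Definition reach (A : set pt) : \bar R :=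
  ereal_sup [set r%:E | r in
    [set r | 0 < r /\ forall x, dist x A < r -> has_unique_projection A x]].

Definition hull (A : set pt) : set pt :=
  smallest (fun B : set pt => convex_set B) A.

End Euclid.

Section LevelSet.
Context {R : realType}.
Local Notation pt := 'rV[R]_2.

Definition partial (i : 'I_2) (G : pt -> R) : pt -> R :=
  fun x => 'D_(delta_mx 0 i) G x.
Definition partials (s : seq 'I_2) (G : pt -> R) : pt -> R :=
  foldr partial G s.

Definition smooth (G : pt -> R) : Prop :=
  forall s x, differentiable (partials s G) x.

Variable F : pt -> R.

Definition Gamma : set pt := [set x | F x = 0].
Definition grad (x : pt) : pt := \row_i partial i F x.
Definition unit_normal (x : pt) : pt := (enorm (grad x))^-1 *: grad x.

Definition bounded_derivatives_near (A : set pt) : Prop :=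
  forall s, exists (U : set pt) (M : R),
    [/\ open U, A `<=` U & forall x, U x -> `|partials s F x| <= M].

(* Signed curvature of a level set of [F]: the divergence of
   [grad F / |grad F|], expanded. *)
Definition curvature (x : pt) : R :=
  let Fx := partials [:: 0] F x in let Fy := partials [:: 1] F x in
  let Fxx := partials [:: 0; 0] F x in let Fxy := partials [:: 0; 1] F x in
  let Fyy := partials [:: 1; 1] F x in
  (Fxx * Fy ^+ 2 - 2 * Fxy * Fx * Fy + Fyy * Fx ^+ 2) / enorm (grad x) ^+ 3.

Definition max_curvature : R := sup [set `|curvature x| | x in Gamma].

Definition smooth_compact_level_curve : Prop :=
  [/\ smooth F, bounded_derivatives_near Gamma, compact Gamma
    & forall x, Gamma x -> grad x != 0].

End LevelSet.

(* A triangle is given by the set [V] of its three vertices; as a point set it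
   is [hull V]. *)
Section Mesh.
Context {R : realType}.
Local Notation pt := 'rV[R]_2.

Definition cross (u v : pt) : R := u 0 0 * v 0 1 - u 0 1 * v 0 0.

Definition triangle (V : set pt) : Prop :=
  exists a b c, V = [set a; b; c] /\ cross (b - a) (c - a) != 0.

(* For distinct triangles [V `&` V'] has 0, 1 or 2 elements: they are disjoint
   or meet exactly in a common vertex or a common edge. *)
Definition conforming_mesh (M : set (set pt)) : Prop :=
  [/\ finite_set M, forall V, M V -> triangle V
    & forall V V', M V -> M V' -> hull V `&` hull V' = hull (V `&` V')].

Definition inscribed_diameter (A : set pt) : R :=
  sup [set d | exists (c : pt) (r : R),
    [/\ 0 < r, d = 2 * r & [set x | enorm (x - c) <= r] `<=` A]].

Definition shape_regular (sigma : R) (M : set (set pt)) : Prop :=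
  forall V, M V -> diam (hull V) <= sigma * inscribed_diameter (hull V).

Definition quasi_uniform (cm CM h : R) (M : set (set pt)) : Prop :=
  forall V, M V -> cm * h <= diam (hull V) <= CM * h.

End Mesh.

Section CutTriangle.
Context {R : realType}.
Local Notation pt := 'rV[R]_2.
Variable F : pt -> R.

Definition cut (V : set pt) : Prop := hull V `&` Gamma F !=set0.

Definition consistent (c0 : R) (V : set pt) : Prop :=
  let hT := diam (hull V) in let K := max_curvature F in
  [/\ ((hT%:E : \bar R) < reach (Gamma F))%E,
      hT * K <= 4^-1
    & forall a, V a -> Num.max (c0 * hT) (K * hT ^+ 2) < dist a (Gamma F)].

Definition apex_labelling (V : set pt) (o0 o1 o2 : pt) : Prop :=
  [/\ V = [set o0; o1; o2], Num.sg (F o1) = Num.sg (F o2)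
    & Num.sg (F o0) <> Num.sg (F o1)].

Definition transverse (c2 : R) (V : set pt) : Prop :=
  forall o0 o1 o2, apex_labelling V o0 o1 o2 ->
  forall z, hull V z -> Gamma F z ->
    c2 <= `|dot (unit_normal F z) ((enorm (o0 - z))^-1 *: (o0 - z))|.

(* The chord [p q] in the coordinates translated so that [o0] is the origin. *)
Definition chord (o0 p q : pt) (lam : R) : pt :=
  (1 - lam) *: (p - o0) + lam *: (q - o0).

Definition local_parametrization (V : set pt) (o0 o1 o2 p q : pt)
    (alpha : R -> R) : Prop :=
  [/\ unique (hull [set o0; o1] `&` Gamma F) p,
      unique (hull [set o0; o2] `&` Gamma F) q
    & forall lam, 0 <= lam <= 1 ->
        unique (fun a => [/\ 0 < a, hull V (o0 + a *: chord o0 p q lam)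
                           & F (o0 + a *: chord o0 p q lam) = 0]) (alpha lam)].

End CutTriangle.

Section DerivativeOnSet.
Context {R : realType} {W : normedModType R}.

(* Derivatives relative to [A]: one-sided at the endpoints of an interval. *)
Definition derivative_on (A : set R) (f g : R -> W) : Prop :=
  forall x, A x ->
    (y - x)^-1 *: (f y - f x) @[y --> within A x^'] --> g x.

Fixpoint nth_derivative_on (A : set R) (n : nat) (f g : R -> W) : Prop :=
  if n is m.+1 then
    exists f1, nth_derivative_on A m f f1 /\ derivative_on A f1 g
  else forall x, A x -> g x = f x.

End DerivativeOnSet.

(* Main.v *)
Require Import Defs.
From mathcomp Require Import ring lra zify.

Set Implicit Arguments.
Unset Strict Implicit.
Unset Printing Implicit Defensive.

Local Open Scope classical_set_scope.
Local Open Scope ring_scope.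

(** Put the apex at the origin, let [x] be the affine parametrization of the
chord, [v] the inverse of [alpha], so that [z = x / v], and let [r] be the
distance from the apex to [p].  One differentiation of [F z = 0] gives
[v' = v (dF x') / (dF x)], with [dF] taken at [z].  A second one brings a
cancellation: with [w = v x' - v' x], for which [z' = w / v^2],
<<
    v'' = D^2F (z', w) / (dF x).
>>
On a straight curve [v] is constant; otherwise the bend enters through [D^2F]
alone, applied to two vectors of size [r] and divided once by [dF x], which is
of exact size [r] by transversality.  Hence [v'' = O(r)], and since [v] equals 1
at both ends, Rolle's theorem gives [v' = O(r)] too ([bigO_discal]).

For the higher derivatives, say that a function has weight [j] if its [k]-th
derivative is [O(r^e)], with [e] the upper half of [j + k], for all [k].  Weights
add up in products, differentiation raises them by one, division by [r] lowers
them by two.  Since [x'] is constant of size [r], [x] has weight 1.  The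
derivatives of [z], [v], [v'] and [(dF x) / r] are polynomials in these
functions, [x], [x'], [1 / v], [r / (dF x)], [1 / r] and the partial derivatives
of [F] along the curve; counting weights in this differential system shows by induction on
the order that [z], [v], [v'] and [(dF x) / r] have weights 1, 0, 1 and 0
([weighted_system]).  Weight 1 for [z] is the estimate, because the upper half
of [n + 1] is [n./2 + 1].

The constants have to be uniform although [p] may lie much nearer to the apex
than [h].  Transversality bounds the logarithmic derivative of the distance to
the apex along the curve, so that all points of the patch are at distances
comparable to [r] ([radial_bounds]), and every bound above is relative to [r],
which is at most the diameter of the triangle.  Also [r] itself is bounded
([dist_size_bounded]): [F] has constant sign outside a large square, so that
either the apex or both other vertices lie in the square, and in the latter
case shape regularity bounds the triangle.

The function [alpha] is only given by a uniqueness property.  Its continuity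
follows by compactness ([unique_scal_cvg]), and its differentiability from the
Caratheodory form of the differentiability of [F] ([derivative_on_scal]). *)

(** * Derivatives relative to a set *)

Section RealLimits.
Context {R : realType} {T : Type} {F : set_system T} (FF : Filter F).
Implicit Types (f g : T -> R) (a b : R).

Lemma cvgrD f g a b : f x @[x --> F] --> a -> g x @[x --> F] --> b ->
  f x + g x @[x --> F] --> a + b.
Proof. exact: cvgD. Qed.

Lemma cvgrM f g a b : f x @[x --> F] --> a -> g x @[x --> F] --> b ->
  f x * g x @[x --> F] --> a * b.
Proof. exact: cvgM. Qed.

Lemma cvgrN f a : f x @[x --> F] --> a -> - f x @[x --> F] --> - a.
Proof. exact: cvgN. Qed.

Lemma cvgrV f a : a != 0 -> f x @[x --> F] --> a ->
  (f x)^-1 @[x --> F] --> a^-1.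
Proof. by move=> a0 fa; apply: (cvgV a0 fa). Qed.

Lemma cvgr_cst a : (fun _ : T => a) x @[x --> F] --> a.
Proof. exact: cvg_cst. Qed.

End RealLimits.
Arguments cvgr_cst {R T F} FF a.
Arguments cvgrD {R T F} FF {f g a b}.
Arguments cvgrM {R T F} FF {f g a b}.
Arguments cvgrN {R T F} FF {f a}.
Arguments cvgrV {R T F} FF {f a}.

Section DerivativeOnCalculus.
Context {R : realType}.
Implicit Types (A : set R) (f g df dg : R -> R).

Lemma near_within_dnbhs A (x : R) :
  \forall y \near within A x^', A y /\ y != x.
Proof.
apply: filterI; first exact: withinT.
by apply: (@cvg_within _ _ _ A); exact: withinT.
Qed.

Lemma cvg_near_eq {T} {U : topologicalType} (F : set_system T) {FF : Filter F}
    (f g : T -> U) (l : U) :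
  (\forall x \near F, g x = f x) -> f x @[x --> F] --> l ->
  g x @[x --> F] --> l.
Proof.
move=> gf; apply: cvg_trans; apply: near_eq_cvg.
by apply: filterS gf => x ->.
Qed.

Let FW A x : Filter (within A x^').
Proof. exact: within_filter. Qed.

Lemma cvg_dnbhs_id A (x : R) : y @[y --> within A x^'] --> x.
Proof.
by move=> B xB; apply: (@cvg_within _ _ _ A); exact: nbhs_dnbhs.
Qed.

Lemma derivative_on_cvg A f df x : derivative_on A f df -> A x ->
  f y @[y --> within A x^'] --> f x.
Proof.
move=> fd Ax.
have h0 := cvgrD (FW A x) (@cvg_dnbhs_id A x) (cvgr_cst (FW A x) (- x)).
have := cvgrD (FW A x) (cvgrM (FW A x) h0 (fd x Ax)) (cvgr_cst (FW A x) (f x)).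
rewrite subrr mul0r add0r; apply: cvg_near_eq.
near=> y.
have [_ yx] : A y /\ y != x by near: y; exact: near_within_dnbhs.
rewrite /GRing.scale /= mulrA mulfV ?mul1r ?subrK// subr_eq0//.
Unshelve. all: by end_near. Qed.

Lemma derivative_on_continuous A f df : derivative_on A f df ->
  {within A, continuous f}.
Proof.
move=> fd; apply/subspace_continuousP => x Ax.
have /= := derivative_on_cvg fd Ax.
move=> h B fB.
have hB : \forall y \near x, y != x -> A y -> B (f y) := h B fB.
change (\forall y \near x, A y -> B (f y)).
apply: filterS hB => y hy Ay; have [->|yx] := eqVneq y x; last exact: (hy yx Ay).
exact: (@nbhs_singleton _ (f x)).
Qed.

Lemma derivative_on_ext A f g df dg : (forall x, A x -> f x = g x) ->
  (forall x, A x -> df x = dg x) -> derivative_on A f df -> derivative_on A g dg.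
Proof.
move=> fg dfg fd x Ax; rewrite -dfg//.
apply: cvg_near_eq (fd x Ax); near=> y.
have [Ay _] : A y /\ y != x by near: y; exact: near_within_dnbhs.
by rewrite !fg.
Unshelve. all: by end_near. Qed.

Lemma derivative_on_cst A (c : R) : derivative_on A (fun _ => c) (fun _ => 0).
Proof.
move=> x Ax; apply: cvg_near_cst; near=> y.
by rewrite subrr scaler0.
Unshelve. all: by end_near. Qed.

Lemma derivative_on_id A : derivative_on A (fun x : R => x) (fun _ => 1).
Proof.
move=> x Ax; apply: cvg_near_cst; near=> y.
have [_ yx] : A y /\ y != x by near: y; exact: near_within_dnbhs.
by rewrite /GRing.scale /= mulVf// subr_eq0.
Unshelve. all: by end_near. Qed.

Lemma derivative_onD A f g df dg : derivative_on A f df -> derivative_on A g dg ->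
  derivative_on A (fun x => f x + g x) (fun x => df x + dg x).
Proof.
move=> fd gd x Ax; apply: cvg_near_eq (cvgrD (FW A x) (fd x Ax) (gd x Ax)).
by near=> y; rewrite /= -scalerDr; congr (_ *: _); ring.
Unshelve. all: by end_near. Qed.

Lemma derivative_onM A f g df dg : derivative_on A f df -> derivative_on A g dg ->
  derivative_on A (fun x => f x * g x) (fun x => df x * g x + f x * dg x).
Proof.
move=> fd gd x Ax.
apply: cvg_near_eq (cvgrD (FW A x) (cvgrM (FW A x) (fd x Ax) (derivative_on_cvg gd Ax))
  (cvgrM (FW A x) (cvgr_cst (FW A x) (f x)) (gd x Ax))).
near=> y; rewrite /= /GRing.scale /=; ring.
Unshelve. all: by end_near. Qed.

Lemma derivative_onV A f df : (forall x, A x -> f x != 0) -> derivative_on A f df ->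
  derivative_on A (fun x => (f x)^-1) (fun x => - df x * ((f x)^-1 * (f x)^-1)).
Proof.
move=> f0 fd x Ax.
apply: cvg_near_eq (cvgrM (FW A x) (cvgrN (FW A x) (fd x Ax))
  (cvgrM (FW A x) (cvgrV (FW A x) (f0 x Ax) (derivative_on_cvg fd Ax)) (cvgr_cst (FW A x) (f x)^-1))).
near=> y.
have [Ay yx] : A y /\ y != x by near: y; exact: near_within_dnbhs.
rewrite /= /GRing.scale /=; field.
by rewrite subr_eq0 yx !f0.
Unshelve. all: by end_near. Qed.

Lemma derivative_onZ A (c : R) f df : derivative_on A f df ->
  derivative_on A (fun x => c * f x) (fun x => c * df x).
Proof.
move=> /(derivative_onM (@derivative_on_cst A c)).
by apply: derivative_on_ext => // x _; rewrite mul0r add0r.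
Qed.

Lemma derivative_on_is_derive (a b : R) f df x : derivative_on `[a, b] f df ->
  x \in `]a, b[ -> is_derive x 1 f (df x).
Proof.
move=> fd xab.
have Ax : `[a, b]%classic x.
  by move: xab; rewrite /= inE /= !in_itv/= => /andP[/ltW-> /ltW->].
have W : y @[y --> x^'] `=>` within `[a, b]%classic x^'.
  move=> B /=; rewrite /within /= => hB.
  have : \forall y \near x^', `[a, b]%classic y.
    apply: nbhs_dnbhs; near=> y; suff: `]a, b[%classic y.
      by rewrite /= !in_itv/= => /andP[/ltW-> /ltW->].
    near: y; apply: near_in_itvoo => //.
  by apply: filterS2 hB => y /[apply].
have h B : nbhs (df x) B ->
    \forall y \near x, y != x -> B ((y - x)^-1 *: (f y - f x)).
  by move=> hB; exact: (W _ (fd x Ax _ hB)).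
have {}h : h^-1 *: ((f \o shift x) (h *: 1) - f x) @[h --> (0:R)^'] --> df x.
  move=> B /h; rewrite (near_shift 0 x) => hx.
  change (\forall h \near (0:R), h != 0 ->
    B (h^-1 *: ((f \o shift x) (h *: 1) - f x))).
  apply: filterS hx => t /= + t0; rewrite subr0 addrK scaler1; apply.
  by rewrite -subr_eq0 addrK.
by split; [apply/cvg_ex; exists (df x)|exact/cvg_lim].
Unshelve. all: by end_near. Qed.

(** One-sided derivatives at the endpoints suffice for the mean value theorem,
which only differentiates in the interior. *)
Lemma derivative_on_MVT (a b : R) f df : a < b -> derivative_on `[a, b] f df ->
  exists2 c, c \in `]a, b[ & f b - f a = df c * (b - a).
Proof.
move=> ab fd.
have fi x : x \in `]a, b[ -> is_derive x 1 f (df x).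
  exact: derivative_on_is_derive fd.
by have [c cab ->] := MVT ab fi (derivative_on_continuous fd); exists c.
Qed.

Lemma derivative_on_subset A B f df : A `<=` B ->
  derivative_on B f df -> derivative_on A f df.
Proof.
move=> AB fd x Ax; have := fd x (AB _ Ax).
apply: cvg_trans; apply: cvg_fmap2; exact: within_subset.
Qed.

Lemma derivative_on_nondecreasing (a b : R) f df :
  derivative_on `[a, b] f df -> (forall x, a <= x <= b -> 0 <= df x) ->
  forall x y, a <= x -> x <= y -> y <= b -> f x <= f y.
Proof.
move=> fd df0 x y ax xy yb; move: xy; rewrite le_eqVlt => /predU1P[->//|xy].
have fd' : derivative_on `[x, y] f df.
  apply: derivative_on_subset fd => t /=; rewrite !in_itv/= => /andP[xt ty].
  by rewrite (le_trans ax xt) (le_trans ty yb).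
have [c] := derivative_on_MVT xy fd'.
rewrite in_itv/= => /andP[xc cy] e; rewrite -subr_ge0 e.
apply: mulr_ge0; last by rewrite subr_ge0 ltW.
by apply: df0; rewrite (le_trans ax (ltW xc)) (le_trans (ltW cy) yb).
Qed.

(** [nth_derivative_on] adds derivatives at the end of the chain, while a
differential system produces them at its start. *)
Lemma nth_derivative_on_first {W : normedModType R} A n (f f1 g : R -> W) :
  derivative_on A f f1 -> nth_derivative_on A n f1 g ->
  nth_derivative_on A n.+1 f g.
Proof.
elim: n g => [|n IH] g fd.
  move=> gf1; exists f; split => //.
  move=> x Ax; rewrite gf1//; exact: fd.
by move=> [g1 [h1 h2]]; exists g1; split => //; exact: IH.
Qed.

End DerivativeOnCalculus.

(** * Vectors of the plane *)

Section PlaneVectors.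
Context {R : realType}.
Local Notation pt := 'rV[R]_2.
Implicit Types (u v w : pt) (a b : R).

Definition vec a b : pt := a *: delta_mx 0 0 + b *: delta_mx 0 1.

Lemma vec0E a b : vec a b 0 0 = a.
Proof. by rewrite /vec !mxE /= mulr1 mulr0 addr0. Qed.

Lemma vec1E a b : vec a b 0 1 = b.
Proof. by rewrite /vec !mxE /= mulr0 mulr1 add0r. Qed.

Lemma eq_vec u v : u 0 0 = v 0 0 -> u 0 1 = v 0 1 -> u = v.
Proof.
move=> e0 e1; apply/rowP => i.
by case: (unliftP 0 i) => [j ->|-> //]; rewrite ord1 (_ : lift _ _ = 1)//; apply/val_inj.
Qed.

Lemma vec_eta u : u = vec (u 0 0) (u 0 1).
Proof. by apply: eq_vec; rewrite ?vec0E ?vec1E. Qed.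

Lemma dotE u v : dot u v = u 0 0 * v 0 0 + u 0 1 * v 0 1.
Proof.
rewrite /dot big_ord_recl big_ord1 (_ : lift _ _ = 1)//; exact/val_inj.
Qed.

Lemma dot_ge0 u : 0 <= dot u u.
Proof. by rewrite dotE; nra. Qed.

Lemma enorm_ge0 u : 0 <= enorm u. Proof. exact: sqrtr_ge0. Qed.

Lemma enorm_sq u : enorm u ^+ 2 = u 0 0 ^+ 2 + u 0 1 ^+ 2.
Proof. by rewrite sqr_sqrtr ?dot_ge0// dotE -!expr2. Qed.

Lemma enorm_le u b : 0 <= b -> u 0 0 ^+ 2 + u 0 1 ^+ 2 <= b ^+ 2 -> enorm u <= b.
Proof. by move=> b0; rewrite -enorm_sq ler_sqr ?nnegrE ?enorm_ge0. Qed.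

Lemma enorm_eq0 u : (enorm u == 0) = (u == 0).
Proof.
apply/idP/eqP => [/eqP e|->]; last by rewrite /enorm dotE !mxE !mulr0 addr0 sqrtr0.
have := enorm_sq u; rewrite e => h; apply: eq_vec; rewrite !mxE; nra.
Qed.

Lemma enorm_gt0 u : (0 < enorm u) = (u != 0).
Proof. by rewrite lt_def enorm_eq0 enorm_ge0 andbT. Qed.

Lemma abs_coord0 u : `|u 0 0| <= enorm u.
Proof.
rewrite -[leRHS]ger0_norm ?enorm_ge0// -ler_sqr ?nnegrE// !real_normK ?num_real//.
by rewrite enorm_sq; nra.
Qed.

Lemma abs_coord1 u : `|u 0 1| <= enorm u.
Proof.
rewrite -[leRHS]ger0_norm ?enorm_ge0// -ler_sqr ?nnegrE// !real_normK ?num_real//.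
by rewrite enorm_sq; nra.
Qed.

Lemma abs_le_sqr a b : 0 <= b -> a ^+ 2 <= b ^+ 2 -> `|a| <= b.
Proof.
by move=> b0 h; rewrite -ler_sqr ?nnegrE// real_normK ?num_real.
Qed.

Lemma abs_dot u v : `|dot u v| <= enorm u * enorm v.
Proof.
apply: abs_le_sqr; first by rewrite mulr_ge0 ?enorm_ge0.
rewrite exprMn !enorm_sq dotE -subr_ge0.
rewrite (_ : _ - _ = (u 0 0 * v 0 1 - u 0 1 * v 0 0) ^+ 2); first exact: sqr_ge0.
by ring.
Qed.

Lemma abs_cross u v : `|cross u v| <= enorm u * enorm v.
Proof.
apply: abs_le_sqr; first by rewrite mulr_ge0 ?enorm_ge0.
rewrite exprMn !enorm_sq /cross -subr_ge0.
rewrite (_ : _ - _ = (u 0 0 * v 0 0 + u 0 1 * v 0 1) ^+ 2); first exact: sqr_ge0.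
by ring.
Qed.

Lemma enorm_le_sum u : enorm u <= `|u 0 0| + `|u 0 1|.
Proof.
apply: enorm_le; first by rewrite addr_ge0.
rewrite sqrrD !real_normK ?num_real// addrAC lerDl mulrn_wge0// mulr_ge0//.
Qed.

Lemma enormZ a u : enorm (a *: u) = `|a| * enorm u.
Proof.
rewrite /enorm; have -> : dot (a *: u) (a *: u) = a ^+ 2 * dot u u.
  by rewrite !dotE !mxE; ring.
by rewrite sqrtrM ?sqr_ge0// sqrtr_sqr.
Qed.

Lemma enormN u : enorm (- u) = enorm u.
Proof. by rewrite -scaleN1r enormZ normrN normr1 mul1r. Qed.

Lemma enormD u v : enorm (u + v) <= enorm u + enorm v.
Proof.
apply: enorm_le; first by rewrite addr_ge0 ?enorm_ge0.
have := abs_dot u v; rewrite ler_norml dotE => /andP[_ h].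
by rewrite sqrrD !enorm_sq !mxE; nra.
Qed.

Lemma norm_le_enorm u : `|u| <= enorm u.
Proof.
rewrite /Num.norm /= mx_normrE; apply/bigmax_leP; split => [|[i j] _ /=]; first exact: enorm_ge0.
rewrite ord1; case: (unliftP 0 j) => [k ->|->]; last exact: abs_coord0.
rewrite ord1 (_ : lift _ _ = 1); first exact: abs_coord1.
exact/val_inj.
Qed.

Lemma coord_le_norm u (i : 'I_2) : `|u 0 i| <= `|u|.
Proof.
rewrite /Num.norm /= mx_normrE.
exact: (le_bigmax _ (fun i : 'I_1 * 'I_2 => `|u i.1 i.2|) (0, i)).
Qed.

Lemma norm_sqr_le_dot u : `|u| ^+ 2 <= dot u u.
Proof.
rewrite dotE -!expr2 -enorm_sq ler_sqr ?nnegrE ?enorm_ge0//; exact: norm_le_enorm.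
Qed.

Lemma cvg_vec {T} {F : set_system T} {FF : Filter F} (f g : T -> R) a b :
  f x @[x --> F] --> a -> g x @[x --> F] --> b ->
  vec (f x) (g x) @[x --> F] --> vec a b.
Proof.
by move=> fa gb; apply: cvgD; apply: cvgZr_tmp.
Qed.

End PlaneVectors.

(** * The chain rule in the plane *)

Section Caratheodory.
Context {R : realType}.
Local Notation pt := 'rV[R]_2.
Implicit Types (H : pt -> R) (Z : pt).

Lemma diff_partial H Z (u : pt) : differentiable H Z ->
  'd H Z u = partial 0 H Z * u 0 0 + partial 1 H Z * u 0 1.
Proof.
move=> dH; rewrite /partial !deriveE// {1}(vec_eta u) /vec linearD !linearZ.
by rewrite /= /GRing.scale /=; congr (_ + _); exact: mulrC.
Qed.

(** Differentiability as an exact identity, whose coefficients [phi] are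
continuous at [Z].  It turns an equation between values of [H] into a linear
equation between increments, to which the limit laws apply. *)
Lemma caratheodory H Z : differentiable H Z ->
  exists phi : 'I_2 -> pt -> R,
    (forall y, H y - H Z = phi 0 y * (y - Z) 0 0 + phi 1 y * (y - Z) 0 1) /\
    (forall i, phi i y @[y --> Z] --> partial i H Z).
Proof.
move=> dH.
pose rem y := H y - H Z - 'd H Z (y - Z).
have rem_small (e : R) : 0 < e -> \forall y \near Z, `|rem y| <= e * `|y - Z|.
  move=> e0.
  have /eqaddoP /(_ e e0) h := diff_locally dH.
  have {}h : \forall k \near (0 : pt), `|H (k + Z) - (H Z + 'd H Z k)| <= e * `|k|.
    exact: h.
  move: h; rewrite (near_shift Z 0) /=; apply: filterS => y /=.
  rewrite sub0r subrK /rem.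
  by rewrite opprD addrA.
(* The remainder is spread over both coordinates in proportion to [y - Z]; at
   [y = Z] the quotient is 0. *)
exists (fun i y => partial i H Z + rem y * ((y - Z) 0 i / dot (y - Z) (y - Z))).
split=> [y|i].
  have [->|yZ] := eqVneq y Z; first by rewrite !subrr !mxE !mulr0 addr0.
  have d0 : dot (y - Z) (y - Z) != 0.
    rewrite dotE -!expr2 -enorm_sq expf_neq0// enorm_eq0 subr_eq0//.
  have -> : H y - H Z = rem y + 'd H Z (y - Z) by rewrite /rem subrK.
  by rewrite diff_partial//; move: (rem y) => r; rewrite dotE in d0 *; field.
have FZ : Filter (nbhs Z) by exact: nbhs_filter.
apply/(@cvgrPdist_le _ _ _ _ FZ) => e e0.
have := rem_small e e0; apply: filterS => y hy.
have [->|yZ] := eqVneq y Z; first by rewrite !subrr !mxE mul0r mulr0 addr0 subrr normr0 ltW.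
have k0 : 0 < `|y - Z| by rewrite normr_gt0 subr_eq0.
have d1 := norm_sqr_le_dot (y - Z).
have d0 : 0 < dot (y - Z) (y - Z) by apply: lt_le_trans d1; rewrite exprn_gt0.
rewrite opprD addrA subrr sub0r normrN !normrM normfV (gtr0_norm d0).
rewrite mulrA ler_pdivrMr//.
apply: le_trans (ler_wpM2l (ltW e0) d1).
by rewrite expr2 mulrA ler_pM//; exact: coord_le_norm.
Qed.

Lemma derivative_on_comp (A : set R) H (f g df dg : R -> R) (o : pt) :
  (forall x, A x -> differentiable H (o + vec (f x) (g x))) ->
  derivative_on A f df -> derivative_on A g dg ->
  derivative_on A (fun x => H (o + vec (f x) (g x)))
    (fun x => partial 0 H (o + vec (f x) (g x)) * df x
            + partial 1 H (o + vec (f x) (g x)) * dg x).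
Proof.
move=> dH fd gd x Ax.
have [phi [phiE phic]] := caratheodory (dH x Ax).
have FW : Filter (within A x^') by exact: within_filter.
have zc : o + vec (f y) (g y) @[y --> within A x^'] --> o + vec (f x) (g x).
  apply: cvgD; first exact: cvg_cst.
  by apply: cvg_vec; [exact: derivative_on_cvg fd Ax|exact: derivative_on_cvg gd Ax].
have pc i : phi i (o + vec (f y) (g y)) @[y --> within A x^'] -->
    partial i H (o + vec (f x) (g x)).
  exact: (@cvg_comp _ _ _ (fun y => o + vec (f y) (g y)) (phi i) _ _ _ zc (phic i)).
apply: cvg_near_eq (cvgrD FW (cvgrM FW (pc 0) (fd x Ax)) (cvgrM FW (pc 1) (gd x Ax))).
near=> y.
rewrite phiE opprD addrACA subrr add0r !mxE /GRing.scale /= !(mulr0,mulr1,addr0,add0r).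
by ring.
Unshelve. all: by end_near. Qed.

End Caratheodory.

(** * Families of functions with weights *)

Section WeightedClasses.
Context {R : realType} {I : Type} (r : I -> R) (r0 : R).
Hypothesis r_gt0 : forall i, 0 < r i.
Hypothesis r_le : forall i, r i <= r0.
Implicit Types (f g : I -> R -> R) (e j k n : nat).

(** Uniform in the member [i] of the family as well as in the parameter. *)
Definition bigO e f := exists C : R,
  forall i t, 0 <= t <= 1 -> `|f i t| <= C * r i ^+ e.

(** Each derivative is worth half a power of [r], and [uphalf] rounds upwards.
Keeping [j] instead of the rounded exponent makes products and derivatives
exact at the level of weights. *)
Fixpoint weighted n j f : Prop := bigO (uphalf j) f /\
  if n is m.+1 then exists g, (forall i, derivative_on `[0, 1] (f i) (g i)) /\
    weighted m j.+1 g
  else True.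

Lemma bigO_ge0 e f : bigO e f -> exists2 C, 0 <= C &
  forall i t, 0 <= t <= 1 -> `|f i t| <= C * r i ^+ e.
Proof.
move=> [C h]; exists `|C| => // i t /h /le_trans; apply.
by rewrite ler_wpM2r ?exprn_ge0 ?(ltW (r_gt0 _))// ler_norm.
Qed.

(** The bound [r0] on [r] pays for the superfluous powers of [r]. *)
Lemma bigO_leq e e' f : (e <= e')%N -> bigO e' f -> bigO e f.
Proof.
move=> ee' /bigO_ge0[C C0 h]; exists (C * r0 ^+ (e' - e)) => i t /h /le_trans; apply.
rewrite -mulrA ler_wpM2l// -{1}(subnK ee') exprD.
rewrite ler_wpM2r ?exprn_ge0 ?(ltW (r_gt0 _))//.
by apply: lerXn2r (r_le i); rewrite nnegrE ?(le_trans (ltW (r_gt0 i)))// ltW.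
Qed.

Lemma bigOD e f g : bigO e f -> bigO e g -> bigO e (fun i t => f i t + g i t).
Proof.
move=> [C hf] [D hg]; exists (C + D) => i t t01.
by rewrite mulrDl (le_trans (ler_normD _ _))// lerD ?hf ?hg.
Qed.

Lemma bigOM e e' f g : bigO e f -> bigO e' g ->
  bigO (e + e') (fun i t => f i t * g i t).
Proof.
move=> [C hf] [D hg]; exists (C * D) => i t t01.
by rewrite exprD mulrACA normrM ler_pM ?hf ?hg.
Qed.

Lemma weighted_bigO n j f : weighted n j f -> bigO (uphalf j) f.
Proof. by case: n => [|n] []. Qed.

Lemma weighted_leq_order n m j f : (m <= n)%N -> weighted n j f -> weighted m j f.
Proof.
elim: m n j f => [|m IH] [|n] j f //= mn; first by case.
by move=> [h [g [fg /IH]]] h'; split => //; exists g; split => //; exact: h'.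
Qed.

Lemma weighted_leq n j k f : (j <= k)%N -> weighted n k f -> weighted n j f.
Proof.
elim: n j k f => [|n IH] j k f jk /= [h].
  by split => //; apply: bigO_leq h; rewrite !uphalfE; lia.
move=> [g [fg gk]]; split; first by apply: bigO_leq h; rewrite !uphalfE; lia.
by exists g; split => //; exact: IH gk.
Qed.

Lemma weighted_ext n j f g : (forall i t, 0 <= t <= 1 -> f i t = g i t) ->
  weighted n j f -> weighted n j g.
Proof.
move=> fg; have fgO e : bigO e f -> bigO e g.
  by move=> [C h]; exists C => i t t01; rewrite -fg ?h.
case: n => [|n] /= [h]; first by split => //; exact: fgO.
move=> [g' [fd gw]]; split; first exact: fgO.
exists g'; split => // i; apply: derivative_on_ext (fd i) => // t.
by rewrite /= in_itv/= => t01; rewrite fg.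
Qed.

Lemma weightedD n j f g : weighted n j f -> weighted n j g ->
  weighted n j (fun i t => f i t + g i t).
Proof.
elim: n j f g => [|n IH] j f g /= [hf wf] [hg wg].
  by split => //; exact: bigOD.
split; first exact: bigOD.
move: wf wg => [f' [fd wf]] [g' [gd wg]].
exists (fun i t => f' i t + g' i t); split => [i|]; last exact: IH.
exact: derivative_onD.
Qed.

(** Rounding up is subadditive: two odd weights even gain a power of [r]. *)
Lemma weightedM n j k f g : weighted n j f -> weighted n k g ->
  weighted n (j + k) (fun i t => f i t * g i t).
Proof.
elim: n j k f g => [|n IH] j k f g wf wg.
  split => //; apply: bigO_leq (bigOM (weighted_bigO wf) (weighted_bigO wg)).
  by rewrite !uphalfE; lia.
have wf1 := weighted_leq_order (leqnSn n) wf.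
have wg1 := weighted_leq_order (leqnSn n) wg.
split.
  apply: bigO_leq (bigOM (weighted_bigO wf) (weighted_bigO wg)).
  by rewrite !uphalfE; lia.
move: wf wg => [_ [f' [fd wf]]] [_ [g' [gd wg]]].
exists (fun i t => f' i t * g i t + f i t * g' i t); split => [i|].
  exact: derivative_onM.
apply: weightedD; first by rewrite -addSn; exact: IH.
by rewrite -addnS; exact: IH.
Qed.

Lemma weighted_cst n (c : I -> R) j : bigO (uphalf j) (fun i _ => c i) ->
  weighted n j (fun i _ => c i).
Proof.
elim: n c j => [|n IH] c j h; first by split.
split => //; exists (fun _ _ => 0); split; first by move=> i; exact: derivative_on_cst.
by apply: (IH (fun=> 0)); exists 0 => i t _; rewrite normr0 mul0r.
Qed.

Lemma weightedZ n j (c : R) f : weighted n j f -> weighted n j (fun i t => c * f i t).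
Proof.
move=> h; rewrite -[j]add0n; apply: (@weightedM _ _ _ (fun _ _ => c)) => //.
by apply: (@weighted_cst _ (fun=> c)); exists `|c| => i t _; rewrite mulr1.
Qed.

Lemma weightedN n j f : weighted n j f -> weighted n j (fun i t => - f i t).
Proof.
by move=> /(weightedZ (-1)); apply: weighted_ext => i t _; rewrite mulN1r.
Qed.

(** The derivative of an inverse is again made of [f'] and the inverse, so that
no information beyond order 0 is needed about the latter. *)
Lemma weightedV n f : (forall i t, 0 <= t <= 1 -> f i t != 0) ->
  bigO 0 (fun i t => (f i t)^-1) -> weighted n 0 f ->
  weighted n 0 (fun i t => (f i t)^-1).
Proof.
move=> f0 h; elim: n => [|n IH] wf; first by split.
have wfn := IH (weighted_leq_order (leqnSn n) wf).
move: wf => [_ [f' [fd wf']]]; split => //.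
exists (fun i t => - f' i t * ((f i t)^-1 * (f i t)^-1)); split.
  move=> i; apply: derivative_onV => // t; rewrite /= in_itv/=; exact: f0.
by rewrite -[1%N]addn0; apply: weightedM; [exact: weightedN|exact: (weightedM wfn wfn)].
Qed.

Lemma weighted_divr n j f : weighted n j.+2 f ->
  weighted n j (fun i t => f i t / r i).
Proof.
have div e g : bigO e.+1 g -> bigO e (fun i t => g i t / r i).
  move=> [C h]; exists C => i t /h.
  by rewrite normrM normfV (gtr0_norm (r_gt0 i)) ler_pdivrMr// -mulrA -exprSr.
elim: n j f => [|n IH] j f /= [h]; first by split => //; exact: div.
move=> [g [fg gw]]; split; first exact: div.
exists (fun i t => g i t / r i); split; last exact: IH.
move=> i; have := derivative_onZ (c := (r i)^-1) (fg i).
by apply: derivative_on_ext => t _; rewrite mulrC.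
Qed.

Lemma weightedS n j f g : bigO (uphalf j) f ->
  (forall i, derivative_on `[0, 1] (f i) (g i)) -> weighted n j.+1 g ->
  weighted n.+1 j f.
Proof. by move=> h fg wg; split => //; exists g. Qed.

Lemma weighted_nth_derivative n j f : weighted n j f -> exists g,
  (forall i, nth_derivative_on `[0, 1] n (f i) (g i)) /\ bigO (uphalf (j + n)) g.
Proof.
elim: n j f => [|n IH] j f /= [h].
  by exists f; rewrite addn0.
move=> [g [fg /IH[d [gd dO]]]]; exists d; rewrite addnS; split => // i.
exact: nth_derivative_on_first (fg i) (gd i).
Qed.

End WeightedClasses.

(** * Curve patches and their differential system *)

Section Patch.
Context {R : realType}.
Local Notation pt := 'rV[R]_2.

(** What the analysis has to know about a cut triangle, in coordinates with
origin [apex].  The bounds [c2], [sg] and [r0] on transversality, on the angle at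
the apex and on the size are shared by all patches, so that a bound uniform over
this type is a bound with a constant depending on [F], [c2], [sg], [r0] only. *)
Record patch (F : pt -> R) (c2 sg r0 : R) := Patch {
  apex : pt;
  pend : pt;
  qend : pt;
  scal : R -> R;
  ray (t : R) : pt := (1 - t) *: pend + t *: qend;
  curve (t : R) : pt := apex + scal t *: ray t;
  pend_neq0 : pend != 0;
  qend_neq0 : qend != 0;
  pend_le : enorm pend <= r0;
  sine : enorm pend * enorm qend <= sg * `|cross pend qend|;
  scal_gt0 : forall t : R, 0 <= t <= 1 -> 0 < scal t;
  scal_0 : scal 0 = 1;
  scal_1 : scal 1 = 1;
  scal_cvg : forall t : R, 0 <= t <= 1 ->
    scal s @[s --> within `[0, 1] t^'] --> scal t;
  curve_Gamma : forall t : R, 0 <= t <= 1 -> F (curve t) = 0;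
  curve_transverse : forall t : R, 0 <= t <= 1 ->
    c2 * (enorm (grad F (curve t)) * enorm (ray t)) <=
      `|dot (grad F (curve t)) (ray t)|
}.

Variables (F : pt -> R) (c2 sg r0 : R).
Hypotheses (c2_gt0 : 0 < c2) (F_smooth : smooth F)
  (F_reg : forall x, Gamma F x -> grad F x != 0).
Variable P : patch F c2 sg r0.

Local Notation p := (pend P).
Local Notation q := (qend P).
Local Notation o := (apex P).
Local Notation alpha := (scal P).
Local Notation "`I01" := (`[0, 1]%classic : set R).

(** From here on [i] is a coordinate; the functions below are the quantities [x],
   [x'], [z], the partial derivatives of [F] at [z], [dF x], [dF x'], [v], [v'],
   [w] and [z']. *)
Definition rayc (i : 'I_2) (t : R) : R := (1 - t) * p 0 i + t * q 0 i.
Definition chordc (i : 'I_2) : R := q 0 i - p 0 i.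
Definition curvec (i : 'I_2) (t : R) : R := alpha t * rayc i t.
Definition Fpart (s : seq 'I_2) (t : R) : R :=
  partials s F (o + vec (curvec 0 t) (curvec 1 t)).
Definition dFray t : R := Fpart [:: 0] t * rayc 0 t + Fpart [:: 1] t * rayc 1 t.
Definition dFchord t : R := Fpart [:: 0] t * chordc 0 + Fpart [:: 1] t * chordc 1.
Definition iscal t : R := (alpha t)^-1.
Definition discal t : R := iscal t * dFchord t / dFray t.
Definition wronskian (i : 'I_2) t : R := iscal t * chordc i - discal t * rayc i t.
Definition dcurvec (i : 'I_2) t : R := wronskian i t * (alpha t * alpha t).
(** Not symmetrized: the order of the two partial derivatives is the one produced
by the chain rule. *)
Definition hessian (u0 u1 v0 v1 : R) t : R :=
  (Fpart [:: 0; 0] t * u0 + Fpart [:: 1; 0] t * u1) * v0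
  + (Fpart [:: 0; 1] t * u0 + Fpart [:: 1; 1] t * u1) * v1.

Lemma rayE i t : ray P t 0 i = rayc i t.
Proof. by rewrite /ray !mxE. Qed.

Lemma curveE t : curve P t = o + vec (curvec 0 t) (curvec 1 t).
Proof.
rewrite /curve; congr (_ + _); apply: eq_vec.
  by rewrite vec0E mxE rayE.
by rewrite vec1E mxE rayE.
Qed.

Lemma FpartE s t : Fpart s t = partials s F (curve P t).
Proof. by rewrite /Fpart curveE. Qed.

Lemma dot_grad (u : pt) t :
  dot (grad F (curve P t)) u = Fpart [:: 0] t * u 0 0 + Fpart [:: 1] t * u 0 1.
Proof. by rewrite dotE !mxE !FpartE. Qed.

Lemma dFrayE t : dFray t = dot (grad F (curve P t)) (ray P t).
Proof. by rewrite dot_grad !rayE. Qed.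

Lemma cross_pq_neq0 : cross p q != 0.
Proof.
apply/eqP => e; have := sine P; rewrite e normr0 mulr0 leNgt.
by rewrite mulr_gt0// enorm_gt0 ?pend_neq0 ?qend_neq0.
Qed.

Lemma ray_neq0 t : ray P t != 0.
Proof.
apply/eqP => e; have [e0 e1] : rayc 0 t = 0 /\ rayc 1 t = 0.
  by rewrite -!rayE e !mxE.
have := cross_pq_neq0; rewrite /cross => /eqP; apply.
move: e0 e1; rewrite /rayc => e0 e1.
have h1 : (1 - t) * (p 0 0 * q 0 1 - p 0 1 * q 0 0) = 0.
  transitivity (((1 - t) * p 0 0 + t * q 0 0) * q 0 1 - ((1 - t) * p 0 1 + t * q 0 1) * q 0 0).
    by ring.
  by rewrite e0 e1 !mul0r subr0.
have h2 : t * (p 0 0 * q 0 1 - p 0 1 * q 0 0) = 0.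
  transitivity (((1 - t) * p 0 1 + t * q 0 1) * p 0 0 - ((1 - t) * p 0 0 + t * q 0 0) * p 0 1).
    by ring.
  by rewrite e0 e1 !mul0r subr0.
lra.
Qed.

Lemma dFray_ge t : 0 <= t <= 1 ->
  c2 * (enorm (grad F (curve P t)) * enorm (ray P t)) <= `|dFray t|.
Proof. by move=> t01; rewrite dFrayE; exact: curve_transverse. Qed.

Lemma dFray_neq0 t : 0 <= t <= 1 -> dFray t != 0.
Proof.
move=> t01; rewrite -normr_gt0; apply: lt_le_trans (dFray_ge t01).
by rewrite !mulr_gt0// enorm_gt0 ?ray_neq0// F_reg//; exact: curve_Gamma.
Qed.

Lemma derivative_on_rayc i : derivative_on `I01 (rayc i) (fun _ => chordc i).
Proof.
have h := derivative_onD (@derivative_on_cst _ `I01 (p 0 i))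
  (derivative_onZ (c := chordc i) (@derivative_on_id _ `I01)).
apply: derivative_on_ext h => t _; last by rewrite mulr1 add0r.
by rewrite /rayc /chordc; ring.
Qed.
Arguments derivative_on_rayc : clear implicits.

(** With the Caratheodory coefficients [phi] at [z t], the equation
[F (z s) - F (z t) = 0] reads [(alpha s - alpha t) N s = - alpha s M s (s - t)],
where [N] and [M] tend to [dF x] and [dF x']. *)
Lemma derivative_on_scal :
  derivative_on `I01 alpha (fun t => - alpha t * dFchord t / dFray t).
Proof.
move=> t It; have t01 : 0 <= t <= 1 by move: It; rewrite /= in_itv.
have FW : Filter (within `I01 t^') by exact: within_filter.
have Fd : differentiable F (curve P t) := F_smooth [::] (curve P t).
have [phi [phiE phic]] := caratheodory Fd.
have rc i := derivative_on_cvg (derivative_on_rayc i) It.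
have zc : curve P s @[s --> within `I01 t^'] --> curve P t.
  have -> : curve P = fun s => o + vec (curvec 0 s) (curvec 1 s).
    by apply: funext => s; rewrite curveE.
  apply: cvgD; first exact: cvg_cst.
  by apply: cvg_vec; apply: cvgrM => //; exact: scal_cvg.
have pc i : phi i (curve P s) @[s --> within `I01 t^'] --> Fpart [:: i] t.
  by rewrite FpartE; exact: (@cvg_comp _ _ _ (curve P) (phi i) _ _ _ zc (phic i)).
pose N s := phi 0 (curve P s) * rayc 0 t + phi 1 (curve P s) * rayc 1 t.
pose M s := phi 0 (curve P s) * chordc 0 + phi 1 (curve P s) * chordc 1.
have Nc : N s @[s --> within `I01 t^'] --> dFray t.
  by apply: cvgrD; apply: cvgrM; by [exact: pc|exact: cvgr_cst].
have Mc : M s @[s --> within `I01 t^'] --> dFchord t.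
  by apply: cvgrD; apply: cvgrM; by [exact: pc|exact: cvgr_cst].
have N0 := dFray_neq0 t01.
apply: cvg_near_eq (cvgrM FW (cvgrM FW (cvgrN FW (scal_cvg t01)) Mc) (cvgrV FW N0 Nc)).
have Nn0 : \forall s \near within `I01 t^', N s != 0.
  apply: (Nc [set x | x != 0]).
  by apply: open_nbhs_nbhs; split => //; exact: open_neq.
near=> s.
have [Is st] : `I01 s /\ s != t by near: s; exact: near_within_dnbhs.
have s01 : 0 <= s <= 1 by move: Is; rewrite /= in_itv.
have Ns : N s != 0 by near: s; exact: Nn0.
have := phiE (curve P s); rewrite !curve_Gamma// subrr.
have cE i : (curve P s - curve P t) 0 i = (alpha s - alpha t) * rayc i t
    + alpha s * ((s - t) * chordc i).
  by rewrite /curve opprD addrACA subrr add0r !mxE /rayc /chordc; ring.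
rewrite !cE => e.
have {}e : (alpha s - alpha t) * N s = - alpha s * M s * (s - t).
  apply/eqP; rewrite -subr_eq0; apply/eqP; rewrite [RHS]e /N /M; ring.
have st0 : s - t != 0 by rewrite subr_eq0.
apply: (mulIf Ns); apply: (mulfI st0).
rewrite /GRing.scale /= !mulrA mulfV// mul1r e mulrAC.
by rewrite -!mulrA [X in _ = X]mulrC; field.
Unshelve. all: by end_near. Qed.

Lemma derivative_on_iscal : derivative_on `I01 iscal discal.
Proof.
have a0 t : `I01 t -> alpha t != 0.
  by rewrite /= in_itv/= => t01; rewrite gt_eqF// scal_gt0.
have := derivative_onV a0 derivative_on_scal.
apply: derivative_on_ext => // t It; rewrite /discal /iscal.
have t01 : 0 <= t <= 1 by move: It; rewrite /= in_itv.
by field; rewrite a0// dFray_neq0.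
Qed.

Lemma derivative_on_curvec i : derivative_on `I01 (curvec i) (dcurvec i).
Proof.
have := derivative_onM derivative_on_scal (derivative_on_rayc i).
apply: derivative_on_ext => // t It.
have t01 : 0 <= t <= 1 by move: It; rewrite /= in_itv.
rewrite /dcurvec /wronskian /discal /iscal.
by field; rewrite (dFray_neq0 t01) (gt_eqF (scal_gt0 P t01)).
Qed.
Arguments derivative_on_curvec : clear implicits.

Lemma derivative_on_Fpart s : derivative_on `I01 (Fpart s)
  (fun t => Fpart (0 :: s) t * dcurvec 0 t + Fpart (1 :: s) t * dcurvec 1 t).
Proof.
apply: derivative_on_comp; [|exact: derivative_on_curvec..].
by move=> t _; exact: F_smooth.
Qed.
Arguments derivative_on_Fpart : clear implicits.

Lemma derivative_on_dFray : derivative_on `I01 dFray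
  (fun t => hessian (dcurvec 0 t) (dcurvec 1 t) (rayc 0 t) (rayc 1 t) t + dFchord t).
Proof.
have h i := derivative_onM (derivative_on_Fpart [:: i]) (derivative_on_rayc i).
apply: derivative_on_ext (derivative_onD (h 0) (h 1)) => // t _.
rewrite /hessian /dFchord.
move: (Fpart [:: 0; 0] t) (Fpart [:: 1; 0] t) (Fpart [:: 0; 1] t) (Fpart [:: 1; 1] t)
  (Fpart [:: 0] t) (Fpart [:: 1] t) (dcurvec 0 t) (dcurvec 1 t) (rayc 0 t) (rayc 1 t)
  => *; ring.
Qed.

Lemma derivative_on_dFchord : derivative_on `I01 dFchord
  (fun t => hessian (dcurvec 0 t) (dcurvec 1 t) (chordc 0) (chordc 1) t).
Proof.
have h i := derivative_onM (derivative_on_Fpart [:: i])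
  (@derivative_on_cst _ `I01 (chordc i)).
apply: derivative_on_ext (derivative_onD (h 0) (h 1)) => // t _.
rewrite /hessian.
move: (Fpart [:: 0; 0] t) (Fpart [:: 1; 0] t) (Fpart [:: 0; 1] t) (Fpart [:: 1; 1] t)
  (Fpart [:: 0] t) (Fpart [:: 1] t) (dcurvec 0 t) (dcurvec 1 t) (rayc 0 t) (rayc 1 t)
  => *; ring.
Qed.

(** The cancellation: the terms with [dF x'] in the derivatives of the numerator
and of the denominator of [v' = v (dF x') / (dF x)] annihilate each other, and
what remains of [x'] and [x] is the combination [w]. *)
Lemma derivative_on_discal : derivative_on `I01 discal
  (fun t => hessian (dcurvec 0 t) (dcurvec 1 t) (wronskian 0 t) (wronskian 1 t) t
            / dFray t).
Proof.
have N0 t : `I01 t -> dFray t != 0.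
  by rewrite /= in_itv/= => t01; exact: dFray_neq0.
have := derivative_onM (derivative_onM derivative_on_iscal derivative_on_dFchord)
  (derivative_onV N0 derivative_on_dFray).
apply: derivative_on_ext => // t It.
rewrite /hessian {1}/wronskian /discal.
move: (dcurvec 0 t) (dcurvec 1 t) => d0 d1.
rewrite /wronskian /discal.
have := N0 t It.
move: (Fpart [:: 0; 0] t) (Fpart [:: 1; 0] t) (Fpart [:: 0; 1] t) (Fpart [:: 1; 1] t)
  (dFchord t) (dFray t) (rayc 0 t) (rayc 1 t) (iscal t) => *.
by field.
Qed.

End Patch.

(** * Comparability of the distances to the apex *)

(** The difference quotient of the exponential, extended continuously, plays the
   role of the Caratheodory coefficient. *)
Lemma derivative_on_expR {R : realType} (A : set R) (g dg : R -> R) :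
  derivative_on A g dg ->
  derivative_on A (fun x => expR (g x)) (fun x => expR (g x) * dg x).
Proof.
move=> gd x Ax; set a := g x.
have FW : Filter (within A x^') by exact: within_filter.
pose phi y := if y == a then expR a else (expR y - expR a) / (y - a).
have phic : phi y @[y --> a] --> expR a.
  have phia : phi a = expR a by rewrite /phi eqxx.
  have : derivable expR a 1 by exact: derivable_expR.
  move=> /cvg_ex[l hl].
  have el : l = expR a.
    have <- : 'D_1 expR a = l by exact/cvg_lim.
    by have [_ ->] := is_derive_expR a.
  suff h : {for a, continuous phi} by rewrite -phia; exact: h.
  apply/continuous_withinNx; rewrite phia -el => B /hl.
  rewrite /= => hB.
  have {}hB : \forall h \near (0:R), h != 0 ->
    B (h^-1 *: ((expR \o shift a) (h *: 1) - expR a)) := hB.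
  move: hB; rewrite (near_shift a 0) => hB.
  change (\forall y \near a, y != a -> B (phi y)).
  apply: filterS hB => y /= + ya; rewrite sub0r subr_eq0 ya => /(_ isT).
  by rewrite /phi (negbTE ya) scaler1 subrK /GRing.scale /= mulrC.
have gc := derivative_on_cvg gd Ax.
have pc : phi (g y) @[y --> within A x^'] --> expR a.
  exact: (@cvg_comp _ _ _ g phi _ _ _ gc phic).
apply: cvg_near_eq (cvgrM FW pc (gd x Ax)).
near=> y.
have -> : expR (g y) - expR (g x) = phi (g y) * (g y - g x).
  rewrite /phi; case: eqVneq => [->|ne]; first by rewrite !subrr mulr0.
  by rewrite divfK// subr_eq0.
by rewrite /GRing.scale /= mulrCA.
Unshelve. all: by end_near. Qed.

Section PatchComparison.
Context {R : realType}.
Local Notation pt := 'rV[R]_2.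
Variables (F : pt -> R) (c2 sg r0 : R).
Hypotheses (c2_gt0 : 0 < c2) (F_smooth : smooth F)
  (F_reg : forall x, Gamma F x -> grad F x != 0).
Variable P : patch F c2 sg r0.
Local Notation "`I01" := (`[0, 1]%classic : set R).
Local Notation p := (enorm (pend P)).
Local Notation q := (enorm (qend P)).

(** A substitute for the length of [x] that is rational in [t]: the product
[alpha * mean_dist] interpolates between the distances of [p] and of [q], and is
comparable to the distance of [z]. *)
Definition mean_dist (t : R) : R := (1 - t) * p + t * q.
Definition slope : R := 4 * sg / c2.

Lemma p_gt0 : 0 < p. Proof. by rewrite enorm_gt0 pend_neq0. Qed.
Lemma q_gt0 : 0 < q. Proof. by rewrite enorm_gt0 qend_neq0. Qed.

Lemma sg_gt0 : 0 < sg.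
Proof.
have := mulr_gt0 p_gt0 q_gt0 => /lt_le_trans /(_ (sine P)).
by rewrite pmulr_lgt0// normr_gt0; exact: cross_pq_neq0.
Qed.

Lemma mean_dist_gt0 t : 0 <= t <= 1 -> 0 < mean_dist t.
Proof.
move=> t01; rewrite /mean_dist; have := p_gt0; have := q_gt0.
by move: p q => a b; nra.
Qed.

(** The distance of a chord point from either side is controlled by the sine of
the angle at the apex. *)
Lemma ray_ge t : 0 <= t <= 1 -> mean_dist t <= 2 * sg * enorm (ray P t).
Proof.
move=> t01; have p0 := p_gt0; have q0 := q_gt0; have s0 := sg_gt0.
have hp : (1 - t) * p <= sg * enorm (ray P t).
  rewrite -(ler_pM2r q0) -mulrA; apply: (@le_trans _ _ ((1 - t) * (sg * `|cross (pend P) (qend P)|))).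
    by rewrite ler_wpM2l ?sine//; lra.
  rewrite mulrCA -mulrA ler_pM2l//; apply: le_trans (abs_cross _ _).
  rewrite -{1}[1 - t]ger0_norm -?normrM; last by lra.
  rewrite le_eqVlt; apply/orP; left; apply/eqP; congr `|_|.
  by rewrite /cross /ray !mxE; ring.
have hq : t * q <= sg * enorm (ray P t).
  rewrite -(ler_pM2l p0) mulrCA; apply: (@le_trans _ _ (t * (sg * `|cross (pend P) (qend P)|))).
    by rewrite ler_wpM2l ?sine//; lra.
  rewrite mulrCA [leRHS]mulrCA ler_pM2l//; apply: le_trans (abs_cross _ _).
  rewrite -{1}[t]ger0_norm -?normrM; last by lra.
  rewrite le_eqVlt; apply/orP; left; apply/eqP; congr `|_|.
  by rewrite /cross /ray !mxE; ring.
rewrite /mean_dist; lra.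
Qed.

Lemma ray_le t : 0 <= t <= 1 -> enorm (ray P t) <= mean_dist t.
Proof.
move=> t01; apply: le_trans (enormD _ _) _.
by rewrite !enormZ /mean_dist !ger0_norm//; lra.
Qed.

Lemma derivative_on_mean_dist : derivative_on `I01 mean_dist (fun _ => q - p).
Proof.
have h := derivative_onD (@derivative_on_cst _ `I01 p)
  (derivative_onZ (c := q - p) (@derivative_on_id _ `I01)).
apply: derivative_on_ext h => t _; last by rewrite mulr1 add0r.
by rewrite /mean_dist; ring.
Qed.

(** The ray through [x t] meets the segment between the unit vectors of [p] and
[q] at the parameter [reparam t]. *)
Definition reparam t := t * q / mean_dist t.

Lemma derivative_on_reparam :
  derivative_on `I01 reparam (fun t => p * q / mean_dist t ^+ 2).
Proof.
have m0 t : `I01 t -> mean_dist t != 0.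
  by rewrite /= in_itv/= => t01; rewrite gt_eqF ?mean_dist_gt0.
have h := derivative_onM (derivative_onZ (c := q) (@derivative_on_id _ `I01))
  (derivative_onV m0 derivative_on_mean_dist).
apply: derivative_on_ext h => t It; first by rewrite /reparam [q * t]mulrC.
have := m0 t It; rewrite /mean_dist => mt; by field.
Qed.

Lemma reparam01 t : 0 <= t <= 1 -> 0 <= reparam t <= 1.
Proof.
move=> t01; have m0 := mean_dist_gt0 t01; have := p_gt0; have := q_gt0.
rewrite /reparam => q0 p0; apply/andP; split.
  by apply: divr_ge0; [apply: mulr_ge0; [lra|exact: ltW]|exact: ltW].
by rewrite ler_pdivrMr// mul1r /mean_dist; nra.
Qed.

Definition dradial t := - scal P t * dFchord P t / dFray P t * mean_dist t
                        + scal P t * (q - p).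

Lemma derivative_on_radial :
  derivative_on `I01 (fun t => scal P t * mean_dist t) dradial.
Proof.
apply: derivative_onM; last exact: derivative_on_mean_dist.
exact: derivative_on_scal.
Qed.

(** The radial derivative is the value of [dF] at a multiple of the difference of
the unit vectors of [p] and [q]; transversality compares it with [dF x]. *)
Lemma dradial_le t : 0 <= t <= 1 ->
  `|dradial t| <= scal P t * mean_dist t * (slope * (p * q / mean_dist t ^+ 2)).
Proof.
move=> t01; have m0 := mean_dist_gt0 t01; have N0 := dFray_neq0 c2_gt0 F_reg P t01.
have a0 := scal_gt0 P t01; have s0 := sg_gt0.
set g := enorm (grad F (curve P t)).
have -> : dradial t = scal P t / dFray P t *
    dot (grad F (curve P t)) (q *: pend P - p *: qend P).
  rewrite /dradial dot_grad /dFchord.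
  have -> : q - p = (q - p) * dFray P t / dFray P t by rewrite mulfK.
  rewrite /mean_dist {2}/dFray /rayc /chordc !mxE.
  by field.
have hd : `|dot (grad F (curve P t)) (q *: pend P - p *: qend P)| <= g * (2 * p * q).
  apply: le_trans (abs_dot _ _) _; rewrite ler_wpM2l ?enorm_ge0//.
  apply: le_trans (enormD _ _) _; rewrite enormN !enormZ !ger0_norm ?enorm_ge0//.
  by move: p q => a b; lra.
have hN : c2 * g * mean_dist t <= 2 * sg * `|dFray P t|.
  apply: (@le_trans _ _ (c2 * g * (2 * sg * enorm (ray P t)))).
    by rewrite ler_wpM2l ?ray_ge// mulr_ge0 ?enorm_ge0// ltW.
  rewrite mulrCA ler_pM2l; last by rewrite mulr_gt0.
  by rewrite -mulrA; exact: dFray_ge.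
rewrite !normrM normfV (gtr0_norm a0) -!mulrA ler_pM2l//.
rewrite ler_pdivrMl ?normr_gt0//; apply: le_trans hd _.
have -> : `|dFray P t| *
    (mean_dist t * (4 * (sg * (c2^-1 * (p * (q / mean_dist t ^+ 2)))))) =
  (2 * sg * `|dFray P t|) * (2 * p * q) / (c2 * mean_dist t).
  by field; rewrite !gt_eqF.
rewrite ler_pdivlMr; last by rewrite mulr_gt0.
rewrite mulrAC ler_wpM2r//; first by rewrite !mulr_ge0 ?enorm_ge0.
by rewrite mulrCA mulrA.
Qed.

(** Gronwall: by [dradial_le] the logarithm of [alpha * mean_dist] moves no faster
than [slope] times [reparam], which stays in the unit interval. *)
Lemma radial_bounds t : 0 <= t <= 1 ->
  p <= expR slope * (scal P t * mean_dist t) /\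
  scal P t * mean_dist t <= expR slope * p.
Proof.
move=> t01; have s0 : 0 <= slope by rewrite /slope !mulr_ge0 ?invr_ge0 ?ltW ?sg_gt0.
have [h1 h2] : p <= scal P t * mean_dist t * expR (slope * reparam t) /\
    scal P t * mean_dist t * expR (- slope * reparam t) <= p.
  have e0 : p = scal P 0 * mean_dist 0.
    by rewrite scal_0 /mean_dist mul0r addr0 subr0 !mul1r.
  have r0' : reparam 0 = 0 by rewrite /reparam !mul0r.
  have D k := derivative_onM derivative_on_radial
    (derivative_on_expR (derivative_onZ (c := k) derivative_on_reparam)).
  have bnd s : 0 <= s <= 1 ->
      - (scal P s * mean_dist s * (slope * (p * q / mean_dist s ^+ 2))) <= dradial s <=
      scal P s * mean_dist s * (slope * (p * q / mean_dist s ^+ 2)).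
    by move=> /dradial_le; rewrite ler_norml.
  split.
    have := @derivative_on_nondecreasing _ _ _ _ _ (D slope) _ 0 t (lexx _).
    rewrite /= r0' mulr0 expR0 mulr1 -e0; apply; try by lra.
    move=> s /bnd /andP[b1 _].
    have := expR_ge0 (slope * reparam s); move: b1.
    move: (expR _) (dradial s) (scal P s * _) (p * q / _) => E d f u b1 E0.
    rewrite (_ : _ + _ = E * (d + f * (slope * u))); last by ring.
    by rewrite mulr_ge0//; lra.
  have := @derivative_on_nondecreasing _ _ _ _ _ (derivative_onZ (c := -1) (D (- slope))) _ 0 t (lexx _).
  rewrite /= r0' mulr0 expR0 mulr1 -e0 !mulN1r lerN2; apply; try by lra.
  move=> s /bnd /andP[_ b2].
  have := expR_ge0 (- slope * reparam s); move: b2.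
  move: (expR _) (dradial s) (scal P s * _) (p * q / _) => E d f u b2 E0.
  rewrite (_ : _ * _ = E * (f * (slope * u) - d)); last by ring.
  by rewrite mulr_ge0//; lra.
have /andP[t0 t1] := reparam01 t01.
have f0 : 0 < scal P t * mean_dist t by rewrite mulr_gt0 ?scal_gt0 ?mean_dist_gt0.
split.
  apply: le_trans h1 _; rewrite mulrC ler_pM2r// ler_expR.
  by rewrite -[leRHS]mulr1 ler_wpM2l.
apply: (@le_trans _ _ (expR (slope * reparam t) * p)).
  rewrite -ler_pdivrMl ?expR_gt0// -expRN -mulNr mulrC; exact: h2.
rewrite ler_pM2r ?p_gt0// ler_expR.
by rewrite -[leRHS]mulr1 ler_wpM2l.
Qed.

Lemma expR_slope_ge1 : 1 <= expR slope.
Proof.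
by rewrite -expR0 ler_expR /slope !mulr_ge0 ?invr_ge0 ?ltW ?sg_gt0.
Qed.

Lemma q_bounds : p <= expR slope * q /\ q <= expR slope * p.
Proof.
have := @radial_bounds 1; rewrite ler01 lexx => /(_ isT).
by rewrite scal_1 /mean_dist subrr mul0r add0r !mul1r.
Qed.

Lemma mean_dist_bounds t : 0 <= t <= 1 ->
  p <= expR slope * mean_dist t /\ mean_dist t <= expR slope * p.
Proof.
move=> t01; have [h1 h2] := q_bounds; have E1 := expR_slope_ge1.
have := p_gt0; move: h1 h2 E1; rewrite /mean_dist.
move: (expR slope) p q => E a b h1 h2 E1 a0.
move: t01 => /andP[t0 t1].
have Ea : a <= E * a by rewrite ler_peMl// ltW.
have u0 : 0 <= 1 - t by lra.
have k1 := ler_wpM2l u0 Ea; have k2 := ler_wpM2l t0 h1; have k3 := ler_wpM2l t0 h2.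
by split; lra.
Qed.

Lemma scal_bounds t : 0 <= t <= 1 ->
  scal P t <= expR slope ^+ 2 /\ (scal P t)^-1 <= expR slope ^+ 2.
Proof.
move=> t01; have [m1 m2] := mean_dist_bounds t01.
have [f1 f2] := radial_bounds t01; have E1 := expR_slope_ge1.
have a0 := scal_gt0 P t01; have m0 := mean_dist_gt0 t01; have p0 := p_gt0.
move: m1 m2 f1 f2 E1 a0 m0 p0.
move: (expR slope) (scal P t) (mean_dist t) p => E a m b m1 m2 f1 f2 E1 a0 m0 b0.
have E0 : 0 < E by lra.
split.
  rewrite -(ler_pM2r m0); apply: le_trans f2 _.
  by rewrite expr2 -mulrA ler_pM2l.
rewrite -[_^-1]mul1r ler_pdivrMr// -(ler_pM2r b0) mul1r; apply: le_trans f1 _.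
by rewrite expr2 -!mulrA ler_pM2l// mulrCA ler_pM2l.
Qed.

End PatchComparison.

(** * Uniform bounds for all derivatives *)

Section UniformEstimate.
Context {R : realType}.
Local Notation pt := 'rV[R]_2.
Variables (F : pt -> R) (c2 sg r0 g0 : R).
Hypotheses (c2_gt0 : 0 < c2) (F_smooth : smooth F) (g0_gt0 : 0 < g0)
  (grad_ge : forall x, Gamma F x -> g0 <= enorm (grad F x))
  (F_bounded : forall s, exists M, forall x, Gamma F x -> `|partials s F x| <= M).

Local Notation I := (patch F c2 sg r0).
Local Notation r := (fun P : I => enorm (pend P)).
Local Notation E := (expR (slope c2 sg)).
Local Notation W := (weighted r).
Local Notation "`I01" := (`[0, 1]%classic : set R).

Lemma F_regular x : Gamma F x -> grad F x != 0.
Proof. by move=> /grad_ge h; rewrite -enorm_gt0; apply: lt_le_trans h. Qed.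

Lemma r_gt0 (P : I) : 0 < r P. Proof. exact: p_gt0. Qed.
Lemma r_le (P : I) : r P <= r0. Proof. exact: pend_le. Qed.

Let WM n j k f g := @weightedM _ _ _ _ r_gt0 r_le n j k f g.
Let WN n j f := @weightedN _ _ _ _ r_gt0 r_le n j f.
Let WD n j f g := @weightedD _ _ r n j f g.
Let WL n j k f := @weighted_leq _ _ _ _ r_gt0 r_le n j k f.

Lemma weighted_chordc n i : W n 2 (fun P _ => chordc P i).
Proof.
apply: (@weighted_cst _ _ r n (fun P => chordc P i) 2).
exists (E + 1) => P t _; have [_ h] := q_bounds c2_gt0 F_smooth F_regular P.
rewrite expr1 mulrDl mul1r /chordc; apply: le_trans (ler_normB _ _) _.
have abs_coord (u : pt) : `|u 0 i| <= enorm u.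
  by apply: le_trans (coord_le_norm u i) (norm_le_enorm u).
by apply: lerD => //; apply: le_trans (abs_coord _) _.
Qed.

Lemma weighted_rayc n i : W n 1 (fun P => rayc P i).
Proof.
have h : bigO r 1 (fun P => rayc P i).
  exists E => P t t01; rewrite expr1 -rayE.
  apply: le_trans (coord_le_norm _ _) (le_trans (norm_le_enorm _) _).
  apply: le_trans (ray_le P t01) _.
  by have [] := mean_dist_bounds c2_gt0 F_smooth F_regular P t01.
case: n => [|n]; first by split.
apply: (weightedS (g := fun P _ => chordc P i)) => //.
  by move=> P; exact: derivative_on_rayc.
exact: weighted_chordc.
Qed.

Lemma scal_neq0 (P : I) t : 0 <= t <= 1 -> scal P t != 0.
Proof. by move=> t01; rewrite gt_eqF ?scal_gt0. Qed.

Lemma bigO_scal : bigO r 0 (fun P : I => scal P).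
Proof.
exists (E ^+ 2) => P t t01; rewrite mulr1 gtr0_norm ?scal_gt0//.
by have [] := scal_bounds c2_gt0 F_smooth F_regular P t01.
Qed.

Lemma bigO_iscal : bigO r 0 (fun P : I => iscal P).
Proof.
exists (E ^+ 2) => P t t01; rewrite mulr1 gtr0_norm ?invr_gt0 ?scal_gt0//.
by have [] := scal_bounds c2_gt0 F_smooth F_regular P t01.
Qed.

(** [alpha] is handled as the inverse of [v], so that [v] alone enters the
induction. *)
Lemma weighted_scal n : W n 0 (fun P : I => iscal P) -> W n 0 (fun P : I => scal P).
Proof.
move=> h; apply: weighted_ext (weightedV r_gt0 r_le _ _ h).
- by move=> P t _; rewrite /iscal invrK.
- by move=> P t t01; rewrite /iscal invr_neq0 ?scal_neq0.
- have [C hC] := bigO_scal; exists C => P t t01.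
  by rewrite /iscal invrK hC.
Qed.

Lemma bigO_Fpart s : bigO r 0 (fun P : I => Fpart P s).
Proof.
have [M hM] := F_bounded s; exists M => P t t01.
by rewrite mulr1 FpartE hM//; exact: curve_Gamma.
Qed.

(** All partial derivatives have to be treated at once, since differentiating one
produces two of higher order; [n] derivatives of [z'] yield [n + 1] of them. *)
Lemma weighted_Fpart n m s : (m <= n.+1)%N ->
  (forall i, W n 1 (fun P => dcurvec P i)) -> W m 0 (fun P : I => Fpart P s).
Proof.
move=> mn wd; elim: m s mn => [|m IH] s mn.
  by split => //; exact: bigO_Fpart.
apply: weightedS; first exact: bigO_Fpart.
  by move=> P; apply: derivative_on_Fpart => //; exact: F_regular.
have wd' i : W m 1 (fun P => dcurvec P i) by apply: weighted_leq_order (wd i).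
by apply: WD; apply: (WM (j := 0) (k := 1)) => //; apply: IH; exact: ltnW.
Qed.

Lemma weighted_hessian n a b (u0 u1 v0 v1 : I -> R -> R) :
  (forall s, W n 0 (fun P : I => Fpart P s)) ->
  W n a u0 -> W n a u1 -> W n b v0 -> W n b v1 ->
  W n (a + b) (fun P t => hessian P (u0 P t) (u1 P t) (v0 P t) (v1 P t) t).
Proof.
move=> wF w0 w1 x0 x1.
have wu s s' : W n a (fun P t => Fpart P s t * u0 P t + Fpart P s' t * u1 P t).
  by apply: WD; exact: (WM (j := 0) (k := a)).
by apply: WD; apply: WM.
Qed.

Lemma weighted_dFchord n : (forall s, W n 0 (fun P : I => Fpart P s)) ->
  W n 2 (fun P : I => dFchord P).
Proof.
by move=> wF; apply: WD; apply: (WM (j := 0) (k := 2)) => //; exact: weighted_chordc.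
Qed.

Definition nFray (P : I) t := dFray P t / r P.

Lemma nFray_neq0 (P : I) t : 0 <= t <= 1 -> nFray P t != 0.
Proof.
move=> t01; apply: mulf_neq0; first exact: (dFray_neq0 c2_gt0 F_regular P t01).
by rewrite invr_neq0// gt_eqF ?r_gt0.
Qed.

(** [|dF x|] is at least [c2 |grad F| |x|] by transversality, and [|x|] is
comparable to [r]. *)
Lemma bigO_nFrayV : bigO r 0 (fun P t => (nFray P t)^-1).
Proof.
exists (2 * sg * E / (c2 * g0)) => P t t01.
have N0 := dFray_neq0 c2_gt0 F_regular P t01.
have s0 := sg_gt0 P; have E0 : 0 < E := expR_gt0 _.
rewrite mulr1 /nFray invfM invrK normrM normfV (gtr0_norm (r_gt0 P)).
rewrite ler_pdivrMl ?normr_gt0// mulrA ler_pdivlMr ?mulr_gt0//.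
have h1 := dFray_ge P t01.
have h2 := ray_ge P t01.
have [h3 _] := mean_dist_bounds c2_gt0 F_smooth F_regular P t01.
have h4 := grad_ge (curve_Gamma P t01).
have g1 : c2 * g0 * enorm (ray P t) <= `|dFray P t|.
  apply: le_trans h1; rewrite -mulrA ler_pM2l// ler_wpM2r ?enorm_ge0//.
apply: (@le_trans _ _ (2 * sg * E * (c2 * g0 * enorm (ray P t)))).
  rewrite mulrC [leRHS]mulrCA ler_pM2l ?mulr_gt0//.
  apply: le_trans h3 _; rewrite [leRHS]mulrAC [leRHS]mulrC ler_pM2l//.
by rewrite [leRHS]mulrC ler_pM2l// !mulr_gt0.
Qed.

(** The formula for [v''] only needs [v' = O(1)] to give [v'' = O(r)]; and [v']
vanishes somewhere because [v] is 1 at both ends. *)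
Lemma bigO_discal : bigO r 1 (fun P : I => discal P) /\ bigO r 0 nFray.
Proof.
have wF s : W 0 0 (fun P : I => Fpart P s) by split => //; exact: bigO_Fpart.
have wv : W 0 0 (fun P : I => iscal P) by split => //; exact: bigO_iscal.
have wa : W 0 0 (fun P : I => scal P) by exact: weighted_scal.
(* At order 0 the weights 1 and 2 both mean [O(r)]; the even one loses nothing
   in products. *)
have wx i : W 0 2 (fun P => rayc P i) by split => //; exact: (weighted_bigO (weighted_rayc 0 i)).
have wN : W 0 0 nFray.
  apply: (weighted_divr r_gt0 (n := 0) (j := 0)).
  by apply: WD; apply: (WM (j := 0) (k := 2)).
have wNV : W 0 0 (fun P t => (nFray P t)^-1) by split => //; exact: bigO_nFrayV.
have wd : W 0 0 (fun P : I => discal P).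
  apply: weighted_ext (WM wv (WM (weighted_divr r_gt0 (weighted_dFchord wF)) wNV)).
  move=> P t t01; rewrite /discal /nFray.
  have N0 := dFray_neq0 c2_gt0 F_regular P t01; have r1 := r_gt0 P.
  move: (iscal P t) (dFchord P t) (dFray P t) N0 (r P) r1 => a b c c0 d d0.
  by field; rewrite c0 gt_eqF.
have ww i : W 0 2 (fun P => wronskian P i).
  apply: WD; first by apply: (WM (j := 0) (k := 2)) => //; exact: weighted_chordc.
  by apply: WN; exact: (WM (j := 0) (k := 2)).
have wz i : W 0 2 (fun P => dcurvec P i).
  by apply: (WM (j := 2) (k := 0)) => //; exact: (WM wa wa).
have wh := WM (weighted_divr r_gt0 (weighted_hessian wF (wz 0) (wz 1) (ww 0) (ww 1))) wNV.
split; last exact: weighted_bigO wN.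
have [C hC] := weighted_bigO wh; exists C => P t t01.
have dd := derivative_on_discal c2_gt0 F_smooth F_regular (P := P).
have dv := derivative_on_iscal c2_gt0 F_smooth F_regular (P := P).
have v01 : iscal P 1 - iscal P 0 = 0 by rewrite /iscal scal_0 scal_1 subrr.
have [c] := derivative_on_MVT ltr01 dv; rewrite in_itv/= => /andP[c0 c1].
rewrite v01 subr0 mulr1 => dc0.
pose h (s : R) := hessian P (dcurvec P 0 s) (dcurvec P 1 s)
  (wronskian P 0 s) (wronskian P 1 s) s / dFray P s.
have hb s : 0 <= s <= 1 -> `|h s| <= C * r P.
  move=> s01; have := hC P s s01; rewrite expr1; congr (`|_| <= _).
  rewrite /h /nFray; have N0 := dFray_neq0 c2_gt0 F_regular P s01; have r1 := r_gt0 P.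
  move: (hessian _ _ _ _ _ _) (dFray P s) N0 (r P) r1 => a e e0 d d0.
  by field; rewrite e0 gt_eqF.
have Cr : 0 <= C * r P by exact: le_trans (normr_ge0 _) (hb t t01).
have key a b : 0 <= a -> a < b -> b <= 1 -> `|discal P b - discal P a| <= C * r P.
  move=> a0 ab b1.
  have dd' : derivative_on `[a, b] (discal P) h.
    apply: derivative_on_subset dd => s /=; rewrite !in_itv/= => /andP[xt ty].
    by rewrite (le_trans a0 xt) (le_trans ty b1).
  have [s] := derivative_on_MVT ab dd'; rewrite in_itv/= => /andP[s0 s1] ->.
  rewrite normrM -[leRHS]mulr1; apply: ler_pM => //.
    by apply: hb; apply/andP; split; lra.
  by rewrite ger0_norm; lra.
rewrite expr1; move: t01 => /andP[t0 t1]; case: (ltgtP t c) => tc.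
- by rewrite -[discal P t]subr0 dc0 -normrN opprB; apply: key => //; exact: ltW.
- by rewrite -[discal P t]subr0 dc0; apply: key => //; exact: ltW.
- by rewrite tc -dc0 normr0.
Qed.

(** The induction of the introduction.  From order [n] of the four functions one
gets order [n] of their derivatives, hence their order [n + 1]. *)
Lemma weighted_system n :
  [/\ forall i, W n 1 (fun P => curvec P i), W n 0 (fun P => iscal P),
      W n 1 (fun P => discal P) & W n 0 nFray].
Proof.
have bz i : bigO r 1 (fun P => curvec P i).
  exact: (bigOM bigO_scal (weighted_bigO (weighted_rayc 0 i))).
have [bd bN] := bigO_discal.
elim: n => [|n [wz wv wd wN]].
  by split => [i|||]; split => //; exact: bigO_iscal.
have wa := weighted_scal wv.
have wNV := weightedV r_gt0 r_le nFray_neq0 bigO_nFrayV wN.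
have ww i : W n 2 (fun P => wronskian P i).
  apply: WD; first by apply: (WM (j := 0) (k := 2)) => //; exact: weighted_chordc.
  by apply: WN; apply: (WM (j := 1) (k := 1)) => //; exact: weighted_rayc.
have wdz i : W n 2 (fun P => dcurvec P i).
  by apply: (WM (j := 2) (k := 0)) => //; exact: (WM wa wa).
have wF s : W n 0 (fun P : I => Fpart P s).
  by apply: (@weighted_Fpart n) => // i; exact: WL (wdz i).
split.
- move=> i; apply: weightedS (wdz i); first exact: bz.
  by move=> P; apply: derivative_on_curvec => //; exact: F_regular.
- apply: weightedS wd; first exact: bigO_iscal.
  by move=> P; apply: derivative_on_iscal => //; exact: F_regular.
- apply: weightedS => [//|P|].
    by apply: derivative_on_discal => //; exact: F_regular.
  apply: weighted_ext (WM (weighted_divr r_gt0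
    (weighted_hessian wF (wdz 0) (wdz 1) (ww 0) (ww 1))) wNV).
  move=> P t t01; rewrite /nFray.
  have N0 := dFray_neq0 c2_gt0 F_regular P t01; have r1 := r_gt0 P.
  move: (hessian _ _ _ _ _ _) (dFray P t) N0 (r P) r1 => a e e0 d d0.
  by field; rewrite e0 gt_eqF.
- apply: weightedS => [//|P|].
    have := derivative_onZ (c := (r P)^-1) (derivative_on_dFray c2_gt0 F_smooth F_regular (P := P)).
    by apply: derivative_on_ext => t _; [rewrite /nFray mulrC|reflexivity].
  have wh := weighted_divr r_gt0 (weighted_hessian wF (wdz 0) (wdz 1)
    (weighted_rayc n 0) (weighted_rayc n 1)).
  apply: weighted_ext (WD wh (WM wd (WM wN wa))).
  move=> P t t01; rewrite /nFray /discal /iscal.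
  have N0 := dFray_neq0 c2_gt0 F_regular P t01; have r1 := r_gt0 P.
  have a0 := scal_neq0 P t01.
  move: (hessian _ _ _ _ _ _) (dFray P t) N0 (r P) r1 (scal P t) a0 (dFchord P t)
    => a e e0 d d0 b b0 m.
  by field; rewrite e0 b0 gt_eqF.
Qed.

Lemma derivative_on_vec (A : set R) (f g df dg : R -> R) :
  derivative_on A f df -> derivative_on A g dg ->
  derivative_on A (fun t => vec (f t) (g t)) (fun t => vec (df t) (dg t)).
Proof.
move=> fd gd x Ax.
have FW : Filter (within A x^') by exact: within_filter.
apply: cvg_near_eq (cvg_vec (FF := FW) (fd x Ax) (gd x Ax)).
near=> y; apply: eq_vec.
  by rewrite vec0E 3!mxE -[in RHS]/(_ *: _) !mxE /= !mulr1 !mulr0 !addr0.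
by rewrite vec1E 3!mxE !mxE /= !mulr1 !mulr0 !add0r.
Unshelve. all: by end_near. Qed.

Lemma nth_derivative_on_vec (A : set R) n (f g df dg : R -> R) :
  nth_derivative_on A n f df -> nth_derivative_on A n g dg ->
  nth_derivative_on A n (fun t => vec (f t) (g t)) (fun t => vec (df t) (dg t)).
Proof.
elim: n df dg => [|n IH] df dg /=; first by move=> hf hg x Ax; rewrite hf ?hg.
move=> [f1 [hf fd]] [g1 [hg gd]]; exists (fun t => vec (f1 t) (g1 t)).
by split; [exact: IH|exact: derivative_on_vec].
Qed.

Theorem patch_estimate n : exists2 C : R, 0 <= C & forall P : I, exists dz : R -> pt,
  nth_derivative_on `I01 n (fun t => scal P t *: ray P t) dz /\
  forall t, 0 <= t <= 1 -> enorm (dz t) <= C * r P ^+ (n./2).+1.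
Proof.
have [wz _ _ _] := weighted_system n.
have [d0 [dz0 /(bigO_ge0 r_gt0)[C0 C00 b0]]] := weighted_nth_derivative (wz 0).
have [d1 [dz1 /(bigO_ge0 r_gt0)[C1 C10 b1]]] := weighted_nth_derivative (wz 1).
exists (C0 + C1); first exact: addr_ge0.
move=> P; exists (fun t => vec (d0 P t) (d1 P t)); split.
  have -> : (fun t => scal P t *: ray P t) = (fun t => vec (curvec P 0 t) (curvec P 1 t)).
    by apply: funext => t; apply: eq_vec; rewrite ?vec0E ?vec1E mxE rayE.
  exact: nth_derivative_on_vec.
move=> t t01; apply: le_trans (enorm_le_sum _) _; rewrite vec0E vec1E mulrDl.
by apply: lerD; [have := b0 P t t01|have := b1 P t t01].
Qed.

End UniformEstimate.

(** * Convex hulls, triangles and the sign of the level function *)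

Section ConvexHull.
Context {R : realType}.
Local Notation pt := 'rV[R]_2.
Implicit Types (A B V : set pt) (x y z : pt).

Lemma convex_setP B : convex_set B <->
  forall x y (t : R), 0 <= t <= 1 -> B x -> B y -> B (t *: x + (1 - t) *: y).
Proof.
split=> [cB x y t /andP[t0 t1] Bx By|cB x y l].
  by have := cB x y (Itv01 t0 t1); rewrite !inE; apply.
rewrite !inE => Bx By; apply: cB => //; apply/andP; split.
  by have := ge0 l.
by have := le1 l.
Qed.

Lemma sub_hull A : A `<=` hull A.
Proof. exact: sub_gen_smallest. Qed.

Lemma hull_sub A B : convex_set B -> A `<=` B -> hull A `<=` B.
Proof. exact: smallest_sub. Qed.

Lemma convex_hull A : convex_set (hull A).
Proof.
apply/convex_setP => x y t t01 hx hy B [cB AB].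
by move/convex_setP: (cB); apply => //; [exact: hx|exact: hy].
Qed.

Lemma subset_hull A B : A `<=` B -> hull A `<=` hull B.
Proof.
by move=> AB; apply: hull_sub; [exact: convex_hull|move=> x /AB; exact: sub_hull].
Qed.

Lemma hull_halfplane A (a b c : R) :
  (forall x, A x -> a * x 0 0 + b * x 0 1 <= c) ->
  forall x, hull A x -> a * x 0 0 + b * x 0 1 <= c.
Proof.
move=> h; apply: (@hull_sub A [set x : pt | a * x 0 0 + b * x 0 1 <= c]) => //.
apply/convex_setP => x y t t01 /= hx hy; rewrite !mxE; nra.
Qed.

Lemma hull_segment (a b z : pt) : hull [set a; b] z ->
  exists2 s : R, 0 <= s <= 1 & z = a + s *: (b - a).
Proof.
apply: (@hull_sub _ [set z | exists2 s : R, 0 <= s <= 1 & z = a + s *: (b - a)]).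
  apply/convex_setP => x y t t01 [s s01 ->] [s' s'01 ->].
  exists (t * s + (1 - t) * s'); first by apply/andP; split; nra.
  by apply: eq_vec; rewrite !mxE; ring.
move=> x [->|->]; [exists 0|exists 1]; rewrite ?lexx ?ler01 ?scale0r ?addr0//.
by rewrite scale1r addrC subrK.
Qed.

Lemma hull_triangle (a b c : pt) (s t : R) : 0 <= s -> 0 <= t -> s + t <= 1 ->
  hull [set a; b; c] (a + (s *: (b - a) + t *: (c - a))).
Proof.
move=> s0 t0 st1; have /convex_setP cH := @convex_hull [set a; b; c].
have Ha : hull [set a; b; c] a by apply: sub_hull; left; left.
have Hb : hull [set a; b; c] b by apply: sub_hull; left; right.
have Hc : hull [set a; b; c] c by apply: sub_hull; right.
have [e|st0] := eqVneq (s + t) 0.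
  have -> : s = 0 by lra.
  have -> : t = 0 by lra.
  by rewrite !scale0r !addr0.
have st_gt0 : 0 < s + t by lra.
have Hbc : hull [set a; b; c] (s / (s + t) *: b + (1 - s / (s + t)) *: c).
  apply: cH => //; apply/andP; split; first by rewrite divr_ge0// ltW.
  by rewrite ler_pdivrMr// mul1r; lra.
have -> : a + (s *: (b - a) + t *: (c - a)) =
    (s + t) *: (s / (s + t) *: b + (1 - s / (s + t)) *: c) + (1 - (s + t)) *: a.
  by apply: eq_vec; rewrite !mxE; field.
by apply: cH => //; apply/andP; split; lra.
Qed.

Lemma hull_enorm_bounded V (M : R) : (forall x, V x -> `|x| <= M) ->
  forall x, hull V x -> enorm x <= M + M.
Proof.
move=> VM x hx; apply: le_trans (enorm_le_sum _) _.
have hp a b : `|a| + `|b| <= 1 -> a * x 0 0 + b * x 0 1 <= M.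
  move=> ab; apply: hull_halfplane hx => y /VM yM.
  have := le_trans (coord_le_norm y 0) yM; have := le_trans (coord_le_norm y 1) yM.
  move: (y 0 0) (y 0 1) => u v vM uM.
  have M0 : 0 <= M by apply: le_trans uM.
  apply: (@le_trans _ _ (`|a| * M + `|b| * M)); last by nra.
  by rewrite lerD// (le_trans (ler_norm _))// normrM ler_wpM2l.
apply: lerD; rewrite ler_norml; apply/andP; split.
- by have := hp (-1) 0; rewrite normrN normr1 normr0 addr0 lexx => /(_ isT); lra.
- by have := hp 1 0; rewrite normr1 normr0 addr0 lexx => /(_ isT); lra.
- by have := hp 0 (-1); rewrite normrN normr1 normr0 add0r lexx => /(_ isT); lra.
- by have := hp 0 1; rewrite normr1 normr0 add0r lexx => /(_ isT); lra.
Qed.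

Lemma finite_norm_bound (a b c : pt) : exists M : R,
  forall x, [set a; b; c] x -> `|x| <= M.
Proof.
exists (`|a| + `|b| + `|c|); have := normr_ge0 a; have := normr_ge0 b.
have := normr_ge0 c => c0 b0 a0.
by move=> x [[]|] ->; lra.
Qed.

Lemma enorm_le_diam (a b c x y : pt) :
  hull [set a; b; c] x -> hull [set a; b; c] y ->
  enorm (x - y) <= diam (hull [set a; b; c]).
Proof.
have [M hM] := finite_norm_bound a b c.
have hb := hull_enorm_bounded hM.
move=> hx hy; apply: ub_le_sup; last by exists x, y.
exists ((M + M) + (M + M)) => _ [u [v [hu hv ->]]].
by apply: le_trans (enormD _ _) _; rewrite enormN lerD// hb.
Qed.

(** The linear form [cross (b - a)] takes on the triangle only values between 0
and twice the signed area; an inscribed disc of diameter [d] spreads it by [d * |b - a|]. *)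
Lemma inscribed_le_cross (a b c : pt) : a != b ->
  inscribed_diameter (hull [set a; b; c]) * enorm (b - a) <=
    `|cross (b - a) (c - a)|.
Proof.
move=> ab; have u0 : 0 < enorm (b - a) by rewrite enorm_gt0 subr_eq0 eq_sym.
rewrite -ler_pdivlMr//; set D := cross _ _.
pose S := [set d | exists (z : pt) (r : R), [/\ 0 < r, d = 2 * r &
  [set x | enorm (x - z) <= r] `<=` hull [set a; b; c]]].
have Sub : ubound S (`|D| / enorm (b - a)).
  move=> d [z [r [r0 -> zr]]]; rewrite ler_pdivlMr//.
  pose n : pt := vec (- (b - a) 0 1) ((b - a) 0 0).
  have nE : enorm n = enorm (b - a).
    by rewrite /enorm !dotE vec0E vec1E; congr Num.sqrt; ring.
  pose w (e : R) := z + (e * (r / enorm (b - a))) *: n.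
  have wH e : `|e| <= 1 -> hull [set a; b; c] (w e).
    move=> e1; apply: zr => /=; rewrite /w [z + _]addrC addrK enormZ nE normrM.
    rewrite (gtr0_norm (divr_gt0 r0 u0)) mulrA divfK ?gt_eqF//.
    by rewrite -[leRHS]mul1r ler_pM2r.
  have crossw e : cross (b - a) (w e - a) =
      cross (b - a) (z - a) + e * r * enorm (b - a).
    have -> : e * r * enorm (b - a) = e * (r / enorm (b - a)) * enorm (b - a) ^+ 2.
      by field; rewrite gt_eqF.
    rewrite enorm_sq /w; move: (e * (r / _)) => k.
    rewrite /cross /n; move: (b - a) => u; rewrite !mxE /=; ring.
  (* An affine function on a triangle ranges between its vertex values. *)
have range x : hull [set a; b; c] x -> Num.min 0 D <= cross (b - a) (x - a) <= Num.max 0 D.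
    move=> hx; have [u uE] : exists u, u = b - a by exists (b - a).
    rewrite -uE.
    have mem y : [set a; b; c] y -> Num.min 0 D <= cross u (y - a) <= Num.max 0 D.
      have cu0 : cross u (a - a) = 0 by rewrite subrr /cross !mxE !mulr0 subrr.
      have cu1 : cross u (b - a) = 0 by rewrite uE /cross; ring.
      have z01 : Num.min 0 D <= 0 <= Num.max 0 D.
        by rewrite ge_min lexx le_max lexx.
      have D01 : Num.min 0 D <= cross u (c - a) <= Num.max 0 D.
        rewrite uE -/D.
        by rewrite ge_min lexx orbT le_max lexx orbT.
      by move=> [[]|] -> //; rewrite ?cu0 ?cu1.
    apply/andP; split.
      rewrite /cross !mxE; move: mem; set m := Num.min 0 D => mem.
      suff : u 0 1 * x 0 0 + - u 0 0 * x 0 1 <= - m - (u 0 0 * a 0 1 - u 0 1 * a 0 0) by lra.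
      apply: (@hull_halfplane [set a; b; c] _ _ _ _ x hx) => y /mem/andP[+ _].
      by rewrite /cross !mxE; lra.
    rewrite /cross !mxE; move: mem; set m := Num.max 0 D => mem.
    suff : - u 0 1 * x 0 0 + u 0 0 * x 0 1 <= m + (u 0 0 * a 0 1 - u 0 1 * a 0 0) by lra.
    apply: (@hull_halfplane [set a; b; c] _ _ _ _ x hx) => y /mem/andP[_].
    by rewrite /cross !mxE; lra.
  have wm : hull [set a; b; c] (w (-1)) by apply: wH; rewrite normrN normr1.
  have wp : hull [set a; b; c] (w 1) by apply: wH; rewrite normr1.
  have /andP[k1 _] := range _ wm; have /andP[_ k2] := range _ wp.
  rewrite !crossw in k1 k2.
  have : Num.max 0 D - Num.min 0 D <= `|D|.
    by case: (leP 0 D) => D0; [rewrite ger0_norm//|rewrite ltr0_norm//]; lra.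
  lra.
rewrite /inscribed_diameter -/S.
have [S0|/set0P/negP/negPn/eqP ->] := pselect (S !=set0); first exact: ge_sup.
by rewrite sup0 divr_ge0// ltW.
Qed.

Lemma inscribed_ge0 (A : set pt) : 0 <= inscribed_diameter A.
Proof.
rewrite /inscribed_diameter; set S := [set d | _].
have [hS|/sup_out ->//] := pselect (has_sup S).
have [[d Sd] ubS] := hS.
apply: (@le_trans _ _ d); last exact: ub_le_sup.
by move: Sd => [z [r [r0 -> _]]]; rewrite mulr_ge0// ltW.
Qed.

(** Shape regularity as a lower bound on the area: the altitude on any side is at
least a fixed fraction of the diameter. *)
Lemma shape_regular_cross (sigma : R) (a b c : pt) : a != b ->
  diam (hull [set a; b; c]) <= sigma * inscribed_diameter (hull [set a; b; c]) ->
  0 < sigma /\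
  diam (hull [set a; b; c]) * enorm (b - a) <= sigma * `|cross (b - a) (c - a)|.
Proof.
move=> ab h; have u0 : 0 < enorm (b - a) by rewrite enorm_gt0 subr_eq0 eq_sym.
have d0 : 0 < diam (hull [set a; b; c]).
  by apply: lt_le_trans u0 (enorm_le_diam _ _); apply: sub_hull; left; [right|left].
have i0 := inscribed_ge0 (hull [set a; b; c]).
have s0 : 0 < sigma.
  rewrite ltNge; apply/negP => s0; have := lt_le_trans d0 h.
  by rewrite ltNge mulr_le0_ge0.
split => //; apply: (@le_trans _ _ (sigma * inscribed_diameter (hull [set a; b; c]) * enorm (b - a))).
  by rewrite ler_pM2r.
by rewrite -mulrA ler_pM2l// inscribed_le_cross.
Qed.

Lemma cross_vertices_neq0 (V : set pt) (o0 o1 o2 : pt) :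
  triangle V -> V = [set o0; o1; o2] -> cross (o1 - o0) (o2 - o0) != 0.
Proof.
move=> [a [b [c [-> abc]]]] e; apply: contra abc => /eqP.
have [Ea Eb Ec] : [/\ [set o0; o1; o2] a, [set o0; o1; o2] b & [set o0; o1; o2] c].
  by split; rewrite -e; [left; left|left; right|right].
rewrite /cross !mxE => D0; apply/eqP.
by case: Ea => [[]|] ->; case: Eb => [[]|] ->; case: Ec => [[]|] ->; lra.
Qed.

End ConvexHull.

Section ConstantSign.
Context {R : realType}.
Local Notation pt := 'rV[R]_2.

Lemma continuous_segment (F : pt -> R) (a b : pt) :
  (forall x, differentiable F x) ->
  {within `[0, 1], continuous (fun t : R => F (a + t *: (b - a)))}.
Proof.
move=> dF.
have h (i : 'I_2) := derivative_onZ (c := (b - a) 0 i) (@derivative_on_id R `[0, 1]).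
rewrite (_ : (fun t : R => _) =
    (fun t => F (a + vec ((b - a) 0 0 * t) ((b - a) 0 1 * t)))).
  exact: (derivative_on_continuous (derivative_on_comp (fun x _ => dF _) (h 0) (h 1))).
apply: funext => t; congr F; congr (_ + _).
by apply: eq_vec; rewrite ?vec0E ?vec1E !mxE; ring.
Qed.

Lemma convex_sg (F : pt -> R) (C : set pt) : (forall x, differentiable F x) ->
  convex_set C -> (forall x, C x -> F x != 0) ->
  forall a b, C a -> C b -> Num.sg (F a) = Num.sg (F b).
Proof.
move=> dF /convex_setP cC C0.
have key a b : C a -> C b -> F a < 0 -> 0 < F b -> False.
  move=> Ca Cb Fa Fb.
  have [|t] := @IVT R (fun t => F (a + t *: (b - a))) 0 1 0 ler01 (continuous_segment (a := a) (b := b) dF).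
    rewrite scale0r addr0 scale1r addrC subrK.
    by rewrite ge_min (ltW Fa) le_max (ltW Fb) orbT.
  rewrite in_itv/= => t01 /eqP; apply/negP; apply: C0.
  rewrite (_ : a + _ = t *: b + (1 - t) *: a); first exact: cC.
  by apply: eq_vec; rewrite !mxE; ring.
move=> a b Ca Cb; have := C0 a Ca; have := C0 b Cb.
case: (ltgtP (F a) 0) => [Fa|Fa|//]; case: (ltgtP (F b) 0) => [Fb|Fb|//] _ _.
- by rewrite !ltr0_sg.
- by have := key a b Ca Cb Fa Fb.
- by have := key b a Cb Ca Fb Fa.
- by rewrite !gtr0_sg.
Qed.

(** The complement of a square is covered by four half-planes, consecutive ones
overlapping. *)
Lemma sg_outside_square (F : pt -> R) (B : R) : (forall x, differentiable F x) ->
  (forall x, F x = 0 -> `|x| <= B) ->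
  forall a b, B < `|a| -> B < `|b| -> Num.sg (F a) = Num.sg (F b).
Proof.
move=> dF hB.
pose H (a b : R) := [set x : pt | B < a * x 0 0 + b * x 0 1].
have half (a b : R) (i : 'I_2) (e : R) : `|e| = 1 ->
    (forall x : pt, a * x 0 0 + b * x 0 1 = e * x 0 i) ->
    forall x y, H a b x -> H a b y -> Num.sg (F x) = Num.sg (F y).
  move=> e1 eE; apply: convex_sg => //.
    apply/convex_setP => x y t t01; rewrite /H /= !eE !mxE mulrDr !(mulrCA e).
    move: (e * _) (e * _) => v u hu hv; move: t01 => /andP[t0 t1].
    case: (ltgtP 0 t) t0 => // [t0 _|<- _]; last by lra.
    have := mulr_gt0 t0 (_ : 0 < u - B); rewrite subr_gt0 => /(_ hu) k1.
    have := mulr_ge0 (_ : 0 <= 1 - t) (_ : 0 <= v - B).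
    by rewrite !subr_ge0 => /(_ t1 (ltW hv)) k2; lra.
  move=> x; rewrite /H /= eE => hx; apply/eqP => /hB; rewrite leNgt => /negP; apply.
  apply: lt_le_trans hx (le_trans _ (coord_le_norm x i)).
  by rewrite -[leRHS]mul1r -e1 -normrM ler_norm.
have hE x : H 1 0 x -> forall y, H 1 0 y -> Num.sg (F x) = Num.sg (F y).
  by move=> hx y; apply: (half _ _ 0 1) hx => [|z]; rewrite ?normr1//; ring.
have hN x : H 0 1 x -> forall y, H 0 1 y -> Num.sg (F x) = Num.sg (F y).
  by move=> hx y; apply: (half _ _ 1 1) hx => [|z]; rewrite ?normr1//; ring.
have hW x : H (-1) 0 x -> forall y, H (-1) 0 y -> Num.sg (F x) = Num.sg (F y).
  by move=> hx y; apply: (half _ _ 0 (-1)) hx => [|z]; rewrite ?normrN ?normr1//; ring.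
have hS x : H 0 (-1) x -> forall y, H 0 (-1) y -> Num.sg (F x) = Num.sg (F y).
  by move=> hx y; apply: (half _ _ 1 (-1)) hx => [|z]; rewrite ?normrN ?normr1//; ring.
pose w : pt := vec (`|B| + 1) (`|B| + 1).
have [wE wN] : H 1 0 w /\ H 0 1 w.
  by rewrite /H /= !vec0E !vec1E; have := ler_norm B; split; lra.
have toW a : B < `|a| -> Num.sg (F a) = Num.sg (F w).
  move=> Ba.
  have : B < `|a 0 0| \/ B < `|a 0 1|.
    case: (ltP B `|a 0 0|) => [|h0]; [by left|right; rewrite ltNge; apply/negP => h1].
    move: Ba; rewrite ltNge => /negP; apply.
    rewrite /Num.norm /= mx_normrE; apply/bigmax_leP; split.
      by apply: le_trans h0.
    move=> [i j] _ /=; rewrite ord1; case: (unliftP 0 j) => [k ->|-> //].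
    by rewrite ord1 (_ : lift _ _ = 1)//; apply/val_inj.
  pose n : pt := vec (- (`|B| + 1)) (`|B| + 1).
  have [nW nN] : H (-1) 0 n /\ H 0 1 n.
    by rewrite /H /= !vec0E !vec1E; have := ler_norm B; split; lra.
  pose s : pt := vec (`|B| + 1) (- (`|B| + 1)).
  have [sE sS] : H 1 0 s /\ H 0 (-1) s.
    by rewrite /H /= !vec0E !vec1E; have := ler_norm B; split; lra.
  move=> [] h.
    case: (leP 0 (a 0 0)) => a0.
      by apply: hE => //; rewrite /H /=; rewrite ger0_norm// in h; lra.
    rewrite (hW a _ n)//; first exact: hN.
    by rewrite /H /=; rewrite ltr0_norm// in h; lra.
  case: (leP 0 (a 0 1)) => a0.
    by apply: hN => //; rewrite /H /=; rewrite ger0_norm// in h; lra.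
  rewrite (hS a _ s)//; first exact: hE.
  by rewrite /H /=; rewrite ltr0_norm// in h; lra.
by move=> a b /toW -> /toW ->.
Qed.

End ConstantSign.

(** * Patches cut out by triangles *)

(** A function with bounded closed graph is continuous: near [t], every [a] away
from [alpha t] violates one of the closed conditions that characterize [alpha s].
The inequality with [k] and [l] expresses that the point stays on the near side
of the edge opposite to the apex. *)
Lemma unique_scal_cvg {R : realType} (F : 'rV[R]_2 -> R) (o p q : 'rV[R]_2)
    (k l A : R) (alpha : R -> R) :
  (forall x, differentiable F x) -> F o != 0 ->
  (forall t : R, 0 <= t <= 1 -> 0 < alpha t <= A /\
    alpha t * ((1 - t) * k + t * l) <= 1 /\
    F (o + alpha t *: ((1 - t) *: p + t *: q)) = 0) ->
  (forall t a : R, 0 <= t <= 1 -> 0 < a -> a * ((1 - t) * k + t * l) <= 1 ->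
    F (o + a *: ((1 - t) *: p + t *: q)) = 0 -> alpha t = a) ->
  forall t : R, 0 <= t <= 1 ->
    alpha s @[s --> within `[0, 1] t^'] --> alpha t.
Proof.
move=> dF Fo sol uniq t t01.
have FW : Filter (within `[0, 1] t^') by exact: within_filter.
apply/(@cvgrPdist_lt _ _ _ _ FW) => e e0.
pose psi (s : R) := (1 - s) * k + s * l.
pose X (s : R) := (1 - s) *: p + s *: q.
pose Q (s a : R) := `|alpha t - a| < e \/ (F (o + a *: X s) != 0 \/ 1 < a * psi s).
have cK : compact (`[0, A] : set R) by exact: segment_compact.
have {cK} hQ : \forall s \near within `[0, 1] t^', `[0, A]%classic `<=` Q s.
  move/compact_near_coveringP: cK; apply => a Ka.
  set G := filter_prod (nbhs a) (within `[0, 1] t^').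
  have FG : Filter G by exact: filter_prod_filter.
  have c1 : z.1 @[z --> G] --> a by exact: cvg_fst.
  have c2 : z.2 @[z --> G] --> t.
    exact: (@cvg_comp _ _ _ (fun z : R * R => z.2) id _ _ _ cvg_snd (@cvg_dnbhs_id _ `[0, 1] t)).
  have c3 : 1 - z.2 @[z --> G] --> 1 - t.
    by apply: cvgrD; [exact: cvgr_cst|exact: cvgrN].
  have cpsi : z.1 * psi z.2 @[z --> G] --> a * psi t.
    apply: (cvgrM FG c1); apply: (cvgrD FG).
      exact: (cvgrM FG c3 (cvgr_cst FG k)).
    exact: (cvgrM FG c2 (cvgr_cst FG l)).
  have cX (i : 'I_2) : z.1 * ((1 - z.2) * p 0 i + z.2 * q 0 i) @[z --> G] -->
      a * ((1 - t) * p 0 i + t * q 0 i).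
    apply: (cvgrM FG c1); apply: (cvgrD FG).
      exact: (cvgrM FG c3 (cvgr_cst FG _)).
    exact: (cvgrM FG c2 (cvgr_cst FG _)).
  have XE b s : o + b *: X s = o + vec (b * ((1 - s) * p 0 0 + s * q 0 0))
      (b * ((1 - s) * p 0 1 + s * q 0 1)).
    by congr (_ + _); apply: eq_vec; rewrite ?vec0E ?vec1E !mxE; ring.
  have cF : F (o + z.1 *: X z.2) @[z --> G] --> F (o + a *: X t).
    have cz : o + z.1 *: X z.2 @[z --> G] --> o + a *: X t.
      rewrite XE; under eq_fun do rewrite XE.
      by apply: cvgD; [exact: cvg_cst|exact: cvg_vec].
    exact: (@cvg_comp _ _ _ (fun z : R * R => o + z.1 *: X z.2) F _ _ _ cz
      (differentiable_continuous (dF (o + a *: X t)))).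
  have [ae|ane] := eqVneq a (alpha t).
    have := @cvgr_dist_lt _ _ _ _ FG _ _ c1 e e0.
    by apply: filterS => z; rewrite {1}ae; left.
  have [Fa|Fa] := eqVneq (F (o + a *: X t)) 0; last first.
    have : \forall z \near G, F (o + z.1 *: X z.2) != 0.
      apply: (cF [set x | x != 0]).
      by apply: open_nbhs_nbhs; split => //; exact: open_neq.
    by apply: filterS => z; right; left.
  have a0 : 0 < a.
    move: Ka; rewrite /= in_itv/= => /andP[a0 _]; rewrite lt_def a0 andbT.
    by apply: contra_neq Fo => a00; rewrite -Fa a00 scale0r addr0.
  have psi1 : 1 < a * psi t.
    by rewrite ltNge; apply: contra ane => h; rewrite (uniq t a).
  have : \forall z \near G, 1 < z.1 * psi z.2.
    apply: (cpsi [set x | 1 < x]).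
    by apply: open_nbhs_nbhs; split => //; exact: open_gt.
  by apply: filterS => z; right; right.
near=> s.
have [Is _] : `[0, 1]%classic s /\ s != t by near: s; exact: near_within_dnbhs.
have s01 : 0 <= s <= 1 by move: Is; rewrite /= in_itv.
have Qs : `[0, A]%classic `<=` Q s by near: s; exact: hQ.
have [/andP[a0 aA] [a1 Fa]] := sol s s01.
have := Qs (alpha s); rewrite /= in_itv/= (ltW a0) aA => /(_ isT) [//|[|]].
  by rewrite Fa eqxx.
by rewrite ltNge a1.
Unshelve. all: by end_near. Qed.

Section CutTrianglePatch.
Context {R : realType}.
Local Notation pt := 'rV[R]_2.
Variables (F : pt -> R) (dF : forall x, differentiable F x).

Lemma enorm_le_norm (u : pt) : enorm u <= `|u| + `|u|.
Proof.
by apply: le_trans (enorm_le_sum u) _; apply: lerD; exact: coord_le_norm.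
Qed.

Lemma dist_gt0 (a : pt) : 0 < dist a (Gamma F) -> F a != 0.
Proof.
move=> d0; apply/eqP => Fa; move: d0; rewrite ltNge => /negP; apply.
have -> : 0 = enorm (a - a) by apply/esym/eqP; rewrite enorm_eq0 subrr.
apply: ge_inf; last by exists a.
by exists 0 => _ [y _ <-]; exact: enorm_ge0.
Qed.

(** If the apex is far away, the two other vertices are near, because [F] changes
sign between them and the apex; then their distance bounds the diameter. *)
Lemma dist_size_bounded (sigma B : R) (o0 o1 o2 p : pt) :
  (forall x, F x = 0 -> `|x| <= B) -> 0 < sigma ->
  o1 != o0 -> hull [set o0; o1; o2] p -> F p = 0 ->
  Num.sg (F o1) = Num.sg (F o2) -> Num.sg (F o0) <> Num.sg (F o1) ->
  diam (hull [set o0; o1; o2]) * enorm (o1 - o0) <=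
    sigma * `|cross (o1 - o0) (o2 - o0)| ->
  enorm (p - o0) <= 4 * B + sigma * (4 * B).
Proof.
move=> hB s0 o10 hp Fp sg12 sg01 hD.
have B0 : 0 <= B by apply: le_trans (hB p Fp).
case: (leP `|o0| B) => [b0|b0].
  apply: (@le_trans _ _ (4 * B)); last by rewrite lerDl !mulr_ge0// ltW.
  apply: le_trans (enormD _ _) _; rewrite enormN.
  by have := enorm_le_norm p; have := enorm_le_norm o0; have := hB p Fp; lra.
have b1 : `|o1| <= B.
  rewrite leNgt; apply/negP => b1; apply: sg01; exact: (sg_outside_square dF hB).
have b2 : `|o2| <= B.
  rewrite leNgt; apply/negP => b2; apply: sg01; rewrite sg12.
  exact: (sg_outside_square dF hB).
apply: (@le_trans _ _ (sigma * (4 * B))); last by rewrite lerDr !mulr_ge0.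
apply: (@le_trans _ _ (diam (hull [set o0; o1; o2]))).
  by apply: enorm_le_diam => //; apply: sub_hull; left; left.
have u0 : 0 < enorm (o1 - o0) by rewrite enorm_gt0 subr_eq0.
rewrite -(ler_pM2r u0); apply: le_trans hD _; rewrite -mulrA ler_pM2l//.
have -> : cross (o1 - o0) (o2 - o0) = cross (o1 - o0) (o2 - o1).
  by rewrite /cross !mxE; ring.
apply: le_trans (abs_cross _ _) _; rewrite mulrC ler_pM2r//.
apply: le_trans (enormD _ _) _; rewrite enormN.
by have := enorm_le_norm o1; have := enorm_le_norm o2; lra.
Qed.

Lemma cut_triangle_patch (sigma B c0 c2 : R) (V : set pt) (o0 o1 o2 p q : pt)
    (alpha : R -> R) :
  (forall x, Gamma F x -> grad F x != 0) ->
  (forall x, F x = 0 -> `|x| <= B) ->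
  0 < c0 -> triangle V ->
  diam (hull V) <= sigma * inscribed_diameter (hull V) ->
  consistent F c0 V -> transverse F c2 V ->
  apex_labelling F V o0 o1 o2 -> local_parametrization F V o0 o1 o2 p q alpha ->
  exists P : patch F c2 sigma (4 * B + `|sigma| * (4 * B)),
    [/\ scal P = alpha, pend P = p - o0, qend P = q - o0 &
        enorm (p - o0) <= diam (hull V)].
Proof.
move=> Freg hB c00 triV shape [_ _ far] trans lab.
have [VE sg12 sg01] := lab; move=> [[[hp Fp] up] [[hq Fq] uq] ha].
have Vo0 : V o0 by rewrite VE; left; left.
have D0 := cross_vertices_neq0 triV VE.
have o10 : o1 != o0.
  apply: contra_neq D0 => ->.
  by rewrite subrr /cross !mxE !mul0r subrr.
have diam0 : 0 <= diam (hull V).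
  have := @enorm_le_diam _ o0 o1 o2 o0 o0; rewrite -VE subrr.
  by move=> h; apply: le_trans (enorm_ge0 _) (h _ _); exact: sub_hull.
have Fo : F o0 != 0.
  apply: dist_gt0; apply: le_lt_trans (far o0 Vo0).
  by rewrite le_max mulr_ge0// ltW.
have o01 : o0 != o1 by rewrite eq_sym.
have := shape; rewrite {1 2}VE => shape'.
have [s0 hD] := shape_regular_cross o01 shape'.
have hpV : hull V p by apply: subset_hull hp; rewrite VE => x [|] ->; [left; left|left; right].
have hqV : hull V q by apply: subset_hull hq; rewrite VE => x [|] ->; [left; left|right].
have [k k01 pE] := hull_segment hp; have [l l01 qE] := hull_segment hq.
have k0 : 0 < k.
  rewrite lt_def; case/andP: k01 => -> _; rewrite andbT; apply: contra_neq Fo => k0.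
  by rewrite -Fp pE k0 scale0r addr0.
have l0 : 0 < l.
  rewrite lt_def; case/andP: l01 => -> _; rewrite andbT; apply: contra_neq Fo => l0.
  by rewrite -Fq qE l0 scale0r addr0.
have pu : p - o0 = k *: (o1 - o0) by rewrite pE addrC addKr.
have qu : q - o0 = l *: (o2 - o0) by rewrite qE addrC addKr.
have o20 : o2 != o0.
  apply: contra_neq D0 => ->.
  by rewrite subrr /cross !mxE !mulr0 subrr.
have p0 : p - o0 != 0 by rewrite pu scaler_eq0 gt_eqF//= subr_eq0.
have q0 : q - o0 != 0 by rewrite qu scaler_eq0 gt_eqF//= subr_eq0.
have pdiam : enorm (p - o0) <= diam (hull V).
  by move: hpV; rewrite VE => ?; apply: enorm_le_diam => //; apply: sub_hull; left; left.
pose x t := (1 - t) *: (p - o0) + t *: (q - o0).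
have a_spec t : 0 <= t <= 1 ->
    [/\ 0 < alpha t, hull V (o0 + alpha t *: x t) & F (o0 + alpha t *: x t) = 0].
  by move=> /ha [].
have a_uniq t a : 0 <= t <= 1 -> 0 < a -> hull V (o0 + a *: x t) ->
    F (o0 + a *: x t) = 0 -> alpha t = a.
  by move=> /ha [_ h] *; apply: h.
have xE t : x t = (((1 - t) * k) *: (o1 - o0) + (t * l) *: (o2 - o0)).
  by rewrite /x pu qu !scalerA.
have psi_hull t a : 0 <= t <= 1 -> 0 < a -> a * ((1 - t) * k + t * l) <= 1 ->
    hull V (o0 + a *: x t).
  move=> t01 a0 h; rewrite xE scalerDr !scalerA VE.
  apply: hull_triangle; last by lra.
    by rewrite !mulr_ge0 ?(ltW a0) ?(ltW k0)//; lra.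
  by rewrite !mulr_ge0 ?(ltW a0) ?(ltW l0)//; lra.
(* The barycentric coordinates of [o1] and [o2] add up to at most 1, written with
   a factor [D] that makes both orientations equal. *)
have hull_psi t a : hull V (o0 + a *: x t) -> a * ((1 - t) * k + t * l) <= 1.
  rewrite VE => hz; set D := cross _ _ in D0.
  pose ca := D * ((o2 - o0) 0 1 - (o1 - o0) 0 1).
  pose cb := D * ((o1 - o0) 0 0 - (o2 - o0) 0 0).
  have D2 : 0 < D ^+ 2 by rewrite exprn_even_gt0.
  have h := @hull_halfplane _ _ ca cb (ca * o0 0 0 + cb * o0 0 1 + D ^+ 2) _ _ hz.
  rewrite -(ler_pM2l D2) mulr1.
  suff e : ca * (o0 + a *: x t) 0 0 + cb * (o0 + a *: x t) 0 1 =
      ca * o0 0 0 + cb * o0 0 1 + D ^+ 2 * (a * ((1 - t) * k + t * l)).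
    rewrite e lerD2l in h; apply: h => y.
    have DE : D = cross (o1 - o0) (o2 - o0) by [].
    move=> [[]|] ->; first by rewrite lerDl ltW.
      by rewrite le_eqVlt; apply/orP; left; apply/eqP; rewrite /ca /cb DE /cross !mxE; ring.
    by rewrite le_eqVlt; apply/orP; left; apply/eqP; rewrite /ca /cb DE /cross !mxE; ring.
  have DE : D = cross (o1 - o0) (o2 - o0) by [].
  by rewrite xE /ca /cb DE /cross !mxE; ring.
have psi_ge t : 0 <= t <= 1 -> Num.min k l <= (1 - t) * k + t * l.
  move=> t01; have : Num.min k l <= k by rewrite ge_min lexx.
  have : Num.min k l <= l by rewrite ge_min lexx orbT.
  by move: (Num.min k l) => m h1 h2; nra.
have m0 : 0 < Num.min k l by rewrite lt_min k0 l0.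
have a_le t : 0 <= t <= 1 -> alpha t <= (Num.min k l)^-1.
  move=> t01; have [a0 hV _] := a_spec t t01.
  rewrite -[leRHS]mul1r ler_pdivlMr//; apply: le_trans (hull_psi _ _ hV).
  by rewrite ler_pM2l// psi_ge.
have a_cvg : forall t : R, 0 <= t <= 1 -> alpha s @[s --> within `[0, 1] t^'] --> alpha t.
  apply: (@unique_scal_cvg _ F o0 (p - o0) (q - o0) k l (Num.min k l)^-1) => //.
    move=> t t01; have [a0 hV Fa] := a_spec t t01.
    by rewrite a0 a_le//; split => //; split => //; exact: hull_psi hV.
  by move=> t a t01 a0 h Fa; apply: a_uniq => //; exact: psi_hull.
have a_0 : alpha 0 = 1.
  apply: a_uniq; rewrite ?lexx ?ler01 ?ltr01 ?scale1r// /x scale0r addr0 subr0 scale1r.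
    by rewrite addrC subrK.
  by rewrite addrC subrK.
have a_1 : alpha 1 = 1.
  apply: a_uniq; rewrite ?lexx ?ler01 ?ltr01 ?scale1r// /x subrr scale0r add0r scale1r.
    by rewrite addrC subrK.
  by rewrite addrC subrK.
have sineP : enorm (p - o0) * enorm (q - o0) <= sigma * `|cross (p - o0) (q - o0)|.
  rewrite pu qu !enormZ (gtr0_norm k0) (gtr0_norm l0).
  have -> : cross (k *: (o1 - o0)) (l *: (o2 - o0)) = k * l * cross (o1 - o0) (o2 - o0).
    by rewrite /cross !mxE; ring.
  rewrite normrM (gtr0_norm (mulr_gt0 k0 l0)) mulrACA [leRHS]mulrCA ler_pM2l ?mulr_gt0//.
  apply: le_trans hD; rewrite mulrC ler_wpM2r ?enorm_ge0//.
  by apply: enorm_le_diam; apply: sub_hull; [right|left; left].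
have size : enorm (p - o0) <= 4 * B + `|sigma| * (4 * B).
  rewrite gtr0_norm//; apply: (dist_size_bounded hB s0 o10 _ Fp sg12 sg01 hD).
  by rewrite -VE.
have x_neq0 t : 0 <= t <= 1 -> 0 < enorm (x t).
  move=> t01; rewrite enorm_gt0; apply: contra_neq D0 => x0.
  have psi0 := lt_le_trans m0 (psi_ge t t01).
  have h : ((1 - t) * k + t * l) * cross (o1 - o0) (o2 - o0) = 
      cross (x t) (o2 - o0) + cross (o1 - o0) (x t).
    by rewrite xE /cross !mxE; ring.
  apply: (mulfI (lt0r_neq0 psi0)); rewrite h x0 mulr0.
  by rewrite /cross !mxE !(mul0r, mulr0) subrr addr0.
have tr t : 0 <= t <= 1 ->
    c2 * (enorm (grad F (o0 + alpha t *: x t)) * enorm (x t)) <=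
      `|dot (grad F (o0 + alpha t *: x t)) (x t)|.
  move=> t01; have [a0 hV Fz] := a_spec t t01.
  have := trans _ _ _ lab _ hV Fz; set z := o0 + _.
  have g0 : 0 < enorm (grad F z) by rewrite enorm_gt0 Freg.
  have x0 := x_neq0 t t01.
  have -> : o0 - z = - alpha t *: x t by rewrite /z opprD addrA subrr add0r scaleNr.
  rewrite /unit_normal enormZ normrN (gtr0_norm a0).
  have -> c d e : dot (c *: grad F z) (d *: (e *: x t)) = c * d * e * dot (grad F z) (x t).
    by rewrite !dotE !mxE; ring.
  have -> : (enorm (grad F z))^-1 / (alpha t * enorm (x t)) * - alpha t =
      - (enorm (grad F z) * enorm (x t))^-1 by field; rewrite !gt_eqF.
  have gx0 : 0 < enorm (grad F z) * enorm (x t) by rewrite mulr_gt0.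
  rewrite mulNr normrN normrM normfV (gtr0_norm gx0) mulrC => h.
  by rewrite -ler_pdivlMr//.
have a_gt0 (t : R) : 0 <= t <= 1 -> 0 < alpha t by move=> /a_spec[].
have a_zero (t : R) : 0 <= t <= 1 -> F (o0 + alpha t *: x t) = 0 by move=> /a_spec[].
exists (@Patch R F c2 sigma _ o0 (p - o0) (q - o0) alpha p0 q0 size sineP a_gt0 a_0 a_1 a_cvg a_zero tr).
by split.
Qed.

End CutTrianglePatch.

(** * Constants of the curve and the estimate *)

Lemma grad_lower_bound (R : realType) (F : 'rV[R]_2 -> R) :
  smooth F -> compact (Gamma F) -> (forall x, Gamma F x -> grad F x != 0) ->
  exists2 g : R, 0 < g & forall x, Gamma F x -> g <= enorm (grad F x).
Proof.
move=> sF cG reg.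
have [G0|/set0P/negP/negPn/eqP e] := pselect (Gamma F !=set0); last first.
  by exists 1 => // x; rewrite e.
pose S (x : 'rV[R]_2) := partial 0 F x * partial 0 F x + partial 1 F x * partial 1 F x.
have SE x : enorm (grad F x) ^+ 2 = S x by rewrite enorm_sq !mxE !expr2.
have cS : {within Gamma F, continuous S}.
  apply: continuous_subspaceT => x.
  have h (i : 'I_2) : partial i F y @[y --> x] --> partial i F x.
    exact: differentiable_continuous (sF [:: i] x).
  have FX : Filter (nbhs x) by exact: nbhs_filter.
  exact: (cvgrD FX (cvgrM FX (h 0) (h 0)) (cvgrM FX (h 1) (h 1))).
have [c] := EVT_min_rV G0 cG cS; rewrite inE => Gc hc.
exists (enorm (grad F c)); first by rewrite enorm_gt0 reg.
move=> x Gx; rewrite -ler_sqr ?nnegrE ?enorm_ge0// !SE.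
by apply: hc; rewrite inE.
Qed.

Lemma bounded_Gamma (R : realType) (F : 'rV[R]_2 -> R) : compact (Gamma F) ->
  exists B : R, forall x, F x = 0 -> `|x| <= B.
Proof.
move=> /compact_bounded[M [_ hM]]; exists (M + 1) => x Fx.
by apply: (hM (M + 1)) => //; rewrite ltrDl.
Qed.

Theorem theorem5p1 (R : realType) (F : 'rV[R]_2 -> R)
    (HF : smooth_compact_level_curve F)
    (sigma cm CM c2 : R) (cm_gt0 : 0 < cm) (c2_gt0 : 0 < c2)
    (n : nat) (n_gt0 : (0 < n)%N) :
  exists C : R, forall (c0 h : R) (M : set (set 'rV[R]_2)),
    0 < c0 -> 0 < h ->
    conforming_mesh M -> shape_regular sigma M -> quasi_uniform cm CM h M ->
    (forall V, M V -> cut F V -> consistent F c0 V /\ transverse F c2 V) ->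
    forall V, M V -> cut F V ->
    forall (o0 o1 o2 p q : 'rV[R]_2) (alpha : R -> R),
      apex_labelling F V o0 o1 o2 ->
      local_parametrization F V o0 o1 o2 p q alpha ->
      exists dnz : R -> 'rV[R]_2,
        nth_derivative_on `[0, 1] n
          (fun lam => alpha lam *: chord o0 p q lam) dnz /\
        forall lam, 0 <= lam <= 1 -> enorm (dnz lam) <= C * h ^+ (n./2).+1.
Proof.
have [F_smooth F_bd F_cpt F_reg] := HF.
have dF x : differentiable F x := F_smooth [::] x.
have F_bounded s : exists M, forall x, Gamma F x -> `|partials s F x| <= M.
  by have [U [M [_ GU hU]]] := F_bd s; exists M => x /GU; exact: hU.
have [g0 g0_gt0 grad_ge] := grad_lower_bound F_smooth F_cpt F_reg.
have [B hB] := bounded_Gamma F_cpt.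
have [C C0 hC] := @patch_estimate R F c2 sigma (4 * B + `|sigma| * (4 * B)) g0
  c2_gt0 F_smooth g0_gt0 grad_ge F_bounded n.
exists (C * CM ^+ (n./2).+1) => c0 h M c00 h0 [_ triM _] shape qu cons V MV cutV.
move=> o0 o1 o2 p q alpha lab par.
have [consV transV] := cons V MV cutV.
have [P [Pa Pp Pq Pd]] := cut_triangle_patch dF F_reg hB c00 (triM V MV)
  (shape V MV) consV transV lab par.
have [dz [dzD dzB]] := hC P; exists dz; split.
  by move: dzD; rewrite /ray Pa Pp Pq.
move=> t t01; apply: le_trans (dzB t t01) _.
rewrite -mulrA ler_wpM2l// -exprMn Pp.
have /andP[_ hV] := qu V MV.
by apply: lerXn2r; rewrite ?nnegrE ?(le_trans (enorm_ge0 _) (le_trans Pd hV)) ?enorm_ge0// (le_trans Pd hV).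
Qed.
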